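(* We have $$\mathcal E^{PCA}_d\le \min\Big(\sqrt{2d}\,\|\Delta\|_2,\ \frac{2\|\Delta\|_2^2}{\lambda_d-\lambda_{d+1}}\Big),$$ with the convention $x/0:=\infty$. If moreover $X$ is sub-Gaussian with constant $C_1$, then $$\mathbb E[\mathcal E^{PCA}_d]\le \min\Big(\frac{\sqrt{4C_2d}\,\operatorname{tr}(\Sigma)}{\sqrt n},\ \frac{4C_2\operatorname{tr}^2(\Sigma)}{n(\lambda_d-\lambda_{d+1})}\Big),$$ where $\operatorname{tr}^2(\Sigma)=(\operatorname{tr}\Sigma)^2$.
   Context: Let $(\mathcal H,\langle\cdot,\cdot\rangle)$ be a separable real Hilbert space of dimension $p\in\mathbb N\cup\{+\infty\}$ with norm $\|\cdot\|$, and let $X$ be a centered $\mathcal H$-valued random variable with $\mathbb E\|X\|^2<\infty$. Its covariance operator is $\Sigma=\mathbb E[X\otimes X]$, where $(u\otimes v)x=\langle v,x\rangle u$. Its eigenvalues (with multiplicity) are $\lambda_1\ge\lambda_2\ge\dots>0$, with corresponding eigenvectors $u_1,u_2,\dots$ which are assumed to form an orthonormal basis of $\mathcal H$ and are fixed in advance; $P_j=u_j\otimes u_j$, so $\Sigma=\sum_{j\ge1}\lambda_jP_j$. Put $P_{\le d}=\sum_{j\le d}P_j$, $P_{>d}=I-P_{\le d}$. Let $X_1,\dots,X_n$ be $n\ge1$ independent copies of $X$, $\hat\Sigma=\frac1n\sum_{i=1}^nX_i\otimes X_i$, with eigenvalues $\hat\lambda_1\ge\hat\lambda_2\ge\dots\ge0$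 and an orthonormal basis of eigenvectors $\hat u_1,\hat u_2,\dots$ (any choice); $\hat P_j=\hat u_j\otimes\hat u_j$, $\hat P_{\le d}=\sum_{j\le d}\hat P_j$, $\hat P_{>d}=I-\hat P_{\le d}$. Put $\Delta=\Sigma-\hat\Sigma$. For operators, $\langle S,T\rangle=\operatorname{tr}(S^*T)$ and $\|S\|_2^2=\operatorname{tr}(S^*S)$ (Hilbert-Schmidt). Here $d$ is an integer with $1\le d<p$. The excess risk is $\mathcal E^{PCA}_d=\langle\Sigma,P_{\le d}-\hat P_{\le d}\rangle$ (equivalently $R(\hat P_{\le d})-R(P_{\le d})$ with $R(P)=\mathbb E\|X-PX\|^2=\langle \Sigma,I-P\rangle$ for a deterministic orthogonal projection $P$, evaluated at $\hat P_{\le d}$). $X$ is sub-Gaussian with constant $C_1$ if $\mathbb E\|X\|^2<\infty$ and $\sup_{k\ge1}k^{-1/2}\mathbb E[|\langle X,u\rangle|^k]^{1/k}\le C_1\mathbb E[\langle X,u\rangle^2]^{1/2}$ for all $u\in\mathcal H$. $C_2>0$ is the smallest constant such that $\mathbb E[\|P_j(\Sigma-\hat\Sigma)P_k\|_2^2]\le C_2\delta\lambda_j\lambda_k/n$ for all $j,k$, with $\delta=1$ if $j\ne k$ and $\delta=2$ if $j=k$. *)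

(* Defs.v *)
From HB Require Import structures.
From mathcomp Require Import all_boot all_order all_algebra.
From mathcomp Require Import all_classical all_reals all_analysis.

Set Implicit Arguments.
Unset Strict Implicit.
Unset Printing Implicit Defensive.

Import Order.TTheory GRing.Theory Num.Theory.
Import numFieldNormedType.Exports.

Local Open Scope classical_set_scope.
Local Open Scope ring_scope.

(* A real Hilbert space is a completeNormedModType H together with an inner
   product ip : {dot H for idfun} such that is_hilbert_norm ip; operators are
   functions H -> H, with their pointwise lmodType structure.
   The dimension is p : option nat, None standing for +oo. Eigenvalues and
   eigenvectors are numbered from 1, so that sequences such as u : nat -> H are
   only relevant at the indices j with dim_index p j. *)
Definition lt_dim (d : nat) (p : option nat) : bool :=
  if p is Some m then (d < m)%N else true.

Definition dim_index (p : option nat) (j : nat) : bool :=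
  (0 < j)%N && lt_dim j.-1 p.

Notation borel H := (g_sigma_algebraType (@open H)).

(* The quotient a / b with the convention a / 0 = +oo. *)
Definition xdiv (R : realType) (a b : R) : \bar R :=
  if b == 0 then +oo%E else (a / b)%:E.

Section Hilbert.
Context (R : realType) (H : completeNormedModType R).
Variable ip : {dot H for idfun}.

Definition is_hilbert_norm : Prop := forall x : H, ip x x = `|x| ^+ 2.

(* This entails that H is separable, of Hilbert dimension p. *)
Definition orthonormal_basis (p : option nat) (e : nat -> H) : Prop :=
  (forall j k, dim_index p j -> dim_index p k -> ip (e j) (e k) = (j == k)%:R)
  /\ (forall x : H,
       \sum_(1 <= j < N.+1 | dim_index p j) ip (e j) x *: e j @[N --> \oo] --> x).

Definition tensor (u v : H) : H -> H := fun x => ip v x *: u.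

Definition proj_le (e : nat -> H) (d : nat) : H -> H :=
  \sum_(1 <= j < d.+1) tensor (e j) (e j).

Definition eigen_decomposition (p : option nat) (A : H -> H)
    (lambda : nat -> R) (e : nat -> H) : Prop :=
  [/\ orthonormal_basis p e,
      forall j, dim_index p j -> A (e j) = lambda j *: e j,
      forall j k, dim_index p j -> dim_index p k -> (j <= k)%N ->
        lambda k <= lambda j
    & forall j, dim_index p j -> 0 <= lambda j].

Definition adjoint (S : H -> H) : H -> H :=
  fun y => xget 0 [set z | forall x, ip (S x) y = ip x z].

(* For a trace-class operator A this does not depend on the orthonormal
   basis e. *)
Definition trace (p : option nat) (e : nat -> H) (A : H -> H) : R :=
  limn (fun N => \sum_(1 <= j < N.+1 | dim_index p j) ip (e j) (A (e j))).

Definition hs_inner (p : option nat) (e : nat -> H) (S A : H -> H) : R :=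
  trace p e (adjoint S \o A).

Definition hs_norm (p : option nat) (e : nat -> H) (S : H -> H) : R :=
  Num.sqrt (hs_inner p e S S).

Section Probability.
Context (disp : measure_display) (T : measurableType disp).
Variable P : probability T R.

(* m is the weak (Pettis) expectation of Y; it agrees with the Bochner
   expectation whenever the norm of Y is integrable. *)
Definition is_expectation (Y : T -> H) (m : H) : Prop :=
  forall v : H, ('E_P[fun w => ip (Y w) v] = (ip m v)%:E)%E.

(* E[X (x) X], where (E[X (x) X]) x = E[(X (x) X) x] since evaluation at x is
   a bounded linear map on operators; the expectation exists as soon as
   E|X|^2 is finite. *)
Definition covariance_operator (X : T -> H) : H -> H :=
  fun x => xget 0 [set m | is_expectation (fun w => tensor (X w) (X w) x) m].

Definition empirical_covariance (n : nat) (Xs : 'I_n -> T -> H) (w : T) :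
    H -> H :=
  n%:R^-1 *: \sum_(i < n) tensor (Xs i w) (Xs i w).

Definition sub_gaussian (X : T -> H) (C1 : R) : Prop :=
  ('E_P[fun w => (`|X w| ^+ 2)%R] < +oo)%E /\
  forall v : H,
    (ereal_sup [set (k%:R `^ (- 2^-1))%R%:E *
                    ('E_P[fun w => (`|ip (X w) v| ^+ k)%R]) `^ k%:R^-1
               | k in [set k : nat | (1 <= k)%N]]
     <= C1%:E * ('E_P[fun w => (ip (X w) v ^+ 2)%R]) `^ 2^-1)%E.

(* The smallest C > 0 with
     E |P_j (Sigma - hat Sigma) P_k|_2^2 <= C delta lambda_j lambda_k / n
   for all j, k, where P_j = u_j (x) u_j. The admissible set is nonempty when X
   is sub-Gaussian; the infimum is 0 by convention when it is empty. *)
Definition smallest_C2 (p : option nat) (lambda : nat -> R) (u : nat -> H)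
    (X : T -> H) (n : nat) (Xs : 'I_n -> T -> H) : R :=
  inf [set C : R | 0 < C /\
    forall j k, dim_index p j -> dim_index p k ->
      ('E_P[fun w => (hs_norm p u
              (tensor (u j) (u j)
               \o (covariance_operator X - empirical_covariance Xs w)
               \o tensor (u k) (u k)) ^+ 2)%R]
       <= (C * (if j == k then 2 else 1) * lambda j * lambda k / n%:R)%R%:E)%E].

Definition mutually_independent (n : nat) (Xs : 'I_n -> T -> borel H) : Prop :=
  forall (J : {set 'I_n}) (B : 'I_n -> set (borel H)),
    (forall i, i \in J -> measurable (B i)) ->
    P (\bigcap_(i in [set` J]) (Xs i @^-1` B i))
    = (\prod_(i in J) P (Xs i @^-1` B i))%E.

Definition independent_copies (X : T -> borel H) (n : nat)
    (Xs : 'I_n -> T -> borel H) : Prop :=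
  mutually_independent Xs /\
  forall (i : 'I_n) (B : set (borel H)), measurable B ->
    P (Xs i @^-1` B) = P (X @^-1` B).

(* <Sigma, P_{<=d} - hat P_{<=d}>, where uh spans the projection hat P. *)
Definition excess_risk (p : option nat) (u : nat -> H) (d : nat)
    (X : T -> H) (uh : nat -> H) : R :=
  hs_inner p u (covariance_operator X) (proj_le u d - proj_le uh d).

End Probability.
End Hilbert.

(* Main.v *)
Require Import Defs.
From HB Require Import structures.
From mathcomp Require Import all_boot all_order all_algebra.
From mathcomp Require Import all_classical all_reals all_analysis.
From mathcomp Require Import measurable_realfun.
From mathcomp Require Import ring lra.

(* Writing q_A(x) = <x, Ax>, Parseval's identity turns the trace
   <A, P_{<=d} - hat P_{<=d}> of a self-adjoint A into the finite sum
   sum_{j<=d} (q_A(u_j) - q_A(hat u_j)). By Ky Fan's principle this is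
   nonpositive for A = hat Sigma, so that the excess risk E is at most
   <Delta, P_{<=d} - hat P_{<=d}>, and for A = Sigma it is at least
   (lambda_d - lambda_{d+1}) B / 2, where B = |P_{<=d} - hat P_{<=d}|_2^2 <= 2d.
   With h = |Delta|_2^2, the Cauchy-Schwarz inequality in the form
   2 E <= t h + B / t for all t > 0 then gives both deterministic bounds, and
   integrates without any appeal to Hoelder's inequality. Finally E[h] is at
   most 2 C_2 tr(Sigma)^2 / n by monotone convergence over the blocks
   |P_j Delta P_k|_2^2. *)

Set Implicit Arguments.
Unset Strict Implicit.
Unset Printing Implicit Defensive.

Import Order.TTheory GRing.Theory Num.Theory.
Import numFieldNormedType.Exports.

Local Open Scope classical_set_scope.
Local Open Scope ring_scope.

(** * Inner products and orthonormal bases *)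

(** Several definitions carry default values, and much of the work keeps them away.
    [covariance_operator] is [0] wherever no weak expectation exists: positivity of the eigenvalues
    excludes this at each eigenvector, and completeness then yields the expectation everywhere.
    [trace] and [hs_norm] are limits, meaningful once partial sums are known to be bounded.
    [smallest_C2] is [0] over an empty set, which fourth moments exclude. The eigenvectors of the
    empirical covariance are chosen outcome by outcome, with no measurability in the outcome. The
    excess risk is therefore dominated pointwise by a measurable function, affine in h, and square
    roots are taken only after integration. The 2 in 2 C_2 is the largest value of delta. For the
    gap bound, t = 2 / gap gives B / t <= E, which is absorbed on the left and leaves E <= 2 h /
    gap; the bound on E[h] then produces the constant 4 C_2. *)

Section inner_product.
Context (R : realType) (H : completeNormedModType R).
Variable ip : {dot H for idfun}.
Implicit Types (x y z v : H) (a : R).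

Lemma ipC x y : ip x y = ip y x.
Proof. by rewrite hermC /= expr0 mul1r. Qed.

Lemma ipDl x y z : ip (x + y) z = ip x z + ip y z.
Proof. exact: linearDl. Qed.

Lemma ipDr x y z : ip x (y + z) = ip x y + ip x z.
Proof. by rewrite ipC ipDl !(ipC x). Qed.

Lemma ipZl a x y : ip (a *: x) y = a * ip x y.
Proof. exact: linearZl_LR. Qed.

Lemma ipZr a x y : ip x (a *: y) = a * ip x y.
Proof. by rewrite ipC ipZl ipC. Qed.

Lemma ipNl x y : ip (- x) y = - ip x y.
Proof. by rewrite -scaleN1r ipZl mulN1r. Qed.

Lemma ipNr x y : ip x (- y) = - ip x y.
Proof. by rewrite ipC ipNl ipC. Qed.

Lemma ipBl x y z : ip (x - y) z = ip x z - ip y z.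
Proof. by rewrite ipDl ipNl. Qed.

Lemma ipBr x y z : ip x (y - z) = ip x y - ip x z.
Proof. by rewrite ipDr ipNr. Qed.

Lemma ip0l x : ip 0 x = 0.
Proof. by rewrite -(scale0r (0 : H)) ipZl mul0r. Qed.

Lemma ip0r x : ip x 0 = 0.
Proof. by rewrite ipC ip0l. Qed.

Lemma ip_suml (I : Type) (r : seq I) (Q : pred I) (F : I -> H) y :
  ip (\sum_(i <- r | Q i) F i) y = \sum_(i <- r | Q i) ip (F i) y.
Proof.
by apply: (big_morph (ip^~ y)) => [u v|]; [exact: ipDl|exact: ip0l].
Qed.

Lemma ip_sumr (I : Type) (r : seq I) (Q : pred I) (F : I -> H) y :
  ip y (\sum_(i <- r | Q i) F i) = \sum_(i <- r | Q i) ip y (F i).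
Proof. by rewrite ipC ip_suml; apply: eq_bigr => i _; rewrite ipC. Qed.

Hypothesis ip_norm : is_hilbert_norm ip.

Lemma ip_ge0 x : 0 <= ip x x.
Proof. by rewrite ip_norm exprn_ge0. Qed.

Lemma ip_inj x y : (forall v, ip x v = ip y v) -> x = y.
Proof.
move=> xy; apply/subr0_eq/eqP; rewrite -normr_eq0 -sqrf_eq0 -ip_norm.
by rewrite ipBl xy subrr.
Qed.

Lemma ip_CauchySchwarz x y : `|ip x y| <= `|x| * `|y|.
Proof.
rewrite -(ler_pXn2r (ltn0Sn 1)) ?nnegrE ?mulr_ge0//.
rewrite exprMn -!ip_norm real_normK ?num_real//.
have [->|y0] := eqVneq y 0; first by rewrite !ip0r mulr0 expr0n.
have yy : 0 < ip y y by rewrite ip_norm exprn_gt0// normr_gt0.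
(* This vector is [ip y y] times the component of [x] orthogonal to [y]; its squared norm is
   [ip y y] times the difference to be shown nonnegative. *)
have := ip_ge0 (ip y y *: x - ip x y *: y).
rewrite !(ipBl, ipBr, ipZl, ipZr) (ipC y x) => h.
rewrite -(ler_pM2l yy) -subr_ge0; apply: le_trans h _.
by rewrite le_eqVlt; apply/orP; left; apply/eqP; ring.
Qed.

Lemma ip_AMGM x y (t : R) : 0 < t -> ip x y *+ 2 <= t * ip x x + t^-1 * ip y y.
Proof.
move=> t0; have := ip_ge0 (t *: x - y).
rewrite !(ipBl, ipBr, ipZl, ipZr) (ipC y x) => h.
rewrite -(ler_pM2l t0) -subr_ge0; apply: le_trans h _.
rewrite le_eqVlt; apply/orP; left; apply/eqP; field; exact: lt0r_neq0.
Qed.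

Lemma normD2_le x y : `|x + y| ^+ 2 <= 2 * `|x| ^+ 2 + 2 * `|y| ^+ 2.
Proof.
rewrite -!ip_norm; have := ip_ge0 (x - y).
rewrite !(ipBl, ipBr, ipDl, ipDr) (ipC y x) => h.
by rewrite -subr_ge0; apply: le_trans h _; lra.
Qed.

Lemma ip_cvgl (T : Type) (F : set_system T) {FF : Filter F} (f : T -> H) x v :
  f @ F --> x -> ip (f t) v @[t --> F] --> ip x v.
Proof.
move=> fx; apply/cvgrPdist_le => e e0.
have v1 : 0 < `|v| + 1 by rewrite ltr_wpDl.
have /cvgrPdist_le /(_ (e / (`|v| + 1))) := fx.
rewrite divr_gt0// => /(_ isT); apply: filterS => t ft.
rewrite -ipBl (le_trans (ip_CauchySchwarz _ _))//.
apply: (le_trans (ler_wpM2r _ ft)) => //.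
by rewrite mulrAC ler_pdivrMr// ler_wpM2l ?ltW// ltrDl.
Qed.

Section basis.
Variables (p : option nat) (e : nat -> H).
Hypothesis ONB : orthonormal_basis ip p e.

(** Pairing with [y] is continuous, so it passes through the expansion of [x] in the basis. *)
Lemma basis_parseval x y :
  \sum_(1 <= j < N.+1 | dim_index p j) ip (e j) x * ip (e j) y
    @[N --> \oo] --> ip x y.
Proof.
have [_ /(_ x) /(@ip_cvgl _ _ _ _ _ y)] := ONB.
by apply: cvg_trans; apply: near_eq_cvg; near=> N;
  rewrite ip_suml; apply: eq_bigr => j _; rewrite ipZl.
Unshelve. all: by end_near. Qed.

Lemma basis_orthonormal j k : dim_index p j -> dim_index p k ->
  ip (e j) (e k) = (j == k)%:R.
Proof. by have [+ _] := ONB; apply. Qed.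

End basis.

End inner_product.
Arguments basis_parseval {R H ip} ip_norm {p e} ONB x y.

(** * Ky Fan's principle and the deterministic bounds *)

Section index_sums.
Context (R : realType).
Variable p : option nat.
Implicit Types f g : nat -> R.

Lemma dim_index_le j d : lt_dim d p -> (1 <= j < d.+1)%N -> dim_index p j.
Proof.
rewrite /dim_index => dp /andP[j0 jd]; rewrite j0/=.
by case: p dp => //= m; apply: leq_ltn_trans; rewrite (leq_trans (leq_pred _)).
Qed.

Lemma index_sum_split d N f : lt_dim d p -> (d <= N)%N ->
  \sum_(1 <= j < N.+1 | dim_index p j) f j =
  \sum_(1 <= j < d.+1) f j + \sum_(d.+1 <= j < N.+1 | dim_index p j) f j.
Proof.
move=> dp dN; rewrite (@big_cat_nat _ _ _ d.+1)//=; congr (_ + _).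
rewrite big_nat_cond [RHS]big_nat_cond; apply: eq_bigl => j.
rewrite andbT; apply: andb_idr; exact: dim_index_le.
Qed.

Lemma index_sum_nd f : (forall j, dim_index p j -> 0 <= f j) ->
  nondecreasing_seq (fun N => \sum_(1 <= j < N.+1 | dim_index p j) f j).
Proof.
move=> f0 m N mN; rewrite [leRHS](@big_cat_nat _ _ _ m.+1)//= lerDl.
by rewrite sumr_ge0.
Qed.

Lemma index_sum_cvg f M : (forall j, dim_index p j -> 0 <= f j) ->
  (forall N, \sum_(1 <= j < N.+1 | dim_index p j) f j <= M) ->
  cvgn (fun N => \sum_(1 <= j < N.+1 | dim_index p j) f j).
Proof.
move=> f0 fM; apply: nondecreasing_is_cvgn; first exact: index_sum_nd.
by exists M => _ [N _ <-].
Qed.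

End index_sums.

Section operators.
Context (R : realType) (H : completeNormedModType R).
Variable ip : {dot H for idfun}.
Hypothesis ip_norm : is_hilbert_norm ip.
Variable p : option nat.

Definition self_adjoint (S : H -> H) := forall x y, ip (S x) y = ip x (S y).

(** [adjoint] picks some representing vector; since the inner product separates points there is only
    one, so any candidate is the one picked. *)
Lemma adjointE (S S' : H -> H) :
  (forall x y, ip (S x) y = ip x (S' y)) -> adjoint ip S = S'.
Proof.
move=> SS'; apply/funext => y; apply: xget_subset1 => [x//|a b /= ha hb].
by apply: (ip_inj ip_norm) => v; rewrite ipC -ha hb ipC.
Qed.

Lemma bessel e x d : orthonormal_basis ip p e -> lt_dim d p ->
  \sum_(1 <= j < d.+1) ip (e j) x ^+ 2 <= `|x| ^+ 2.
Proof.
move=> ONB dp; rewrite -ip_norm.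
have le_N N : (d <= N)%N -> \sum_(1 <= j < d.+1) ip (e j) x ^+ 2 <=
    \sum_(1 <= j < N.+1 | dim_index p j) ip (e j) x * ip (e j) x.
  move=> dN; rewrite (index_sum_split _ dp dN).
  under eq_bigr do rewrite expr2.
  by rewrite lerDl sumr_ge0// => j _; rewrite -expr2 sqr_ge0.
apply: (cvgr_to_ge (basis_parseval ip_norm ONB x x)).
by near=> N; apply: le_N; near: N; exact: nbhs_infty_ge.
Unshelve. all: by end_near. Qed.

Lemma bessel_full e x N : orthonormal_basis ip p e ->
  \sum_(1 <= j < N.+1 | dim_index p j) ip (e j) x ^+ 2 <= `|x| ^+ 2.
Proof.
move=> ONB; rewrite -ip_norm.
have nd := @index_sum_nd R p (fun j => ip (e j) x ^+ 2) (fun j _ => sqr_ge0 _).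
apply: (cvgr_to_ge (basis_parseval ip_norm ONB x x)).
near=> M; apply: (@le_trans _ _ _ _ _ (nd N M _)).
  by near: M; exact: nbhs_infty_ge.
by apply: ler_sum => j _; rewrite expr2.
Unshelve. all: by end_near. Qed.

(** By Parseval the form is the sum of [lambda k * ip (e k) x ^+ 2]. Split [lambda k] as
    [(lambda k - mu) + mu] with [mu = lambda d.+1]: Bessel handles the [mu] part, and beyond [d] the
    other part is nonpositive. *)
Lemma eigen_quad_le (A : H -> H) lambda e d x :
  self_adjoint A -> eigen_decomposition ip p A lambda e ->
  (0 < d)%N -> lt_dim d p ->
  ip x (A x) <= \sum_(1 <= k < d.+1) (lambda k - lambda d.+1) * ip (e k) x ^+ 2
                + lambda d.+1 * `|x| ^+ 2.
Proof.
move=> Asa [ONB Ae mono lge0] d0 dp.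
set mu := lambda d.+1.
(* [dim_index p d.+1] unfolds to [lt_dim d p], so index [d.+1] is still within the dimension. *)
have mu_ge0 : 0 <= mu by apply: lge0.
apply: (cvgr_to_le (basis_parseval ip_norm ONB x (A x))).
near=> N.
have dN : (d <= N)%N by near: N; exact: nbhs_infty_ge.
have -> : \sum_(1 <= j < N.+1 | dim_index p j) ip (e j) x * ip (e j) (A x) =
          \sum_(1 <= j < N.+1 | dim_index p j) lambda j * ip (e j) x ^+ 2.
  by apply: eq_bigr => j jp; rewrite -Asa Ae// ipZl expr2 mulrCA.
have bx := bessel_full x N ONB.
apply: le_trans (lerD (lexx _) (ler_wpM2l mu_ge0 bx)).
rewrite !(index_sum_split _ dp dN) mulrDr addrA -lerBlDl addrAC.
rewrite mulr_sumr -big_split /=.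
rewrite [X in X - _ + _](_ : _ = \sum_(1 <= j < d.+1)
   ((lambda j - mu) * ip (e j) x ^+ 2 + mu * ip (e j) x ^+ 2)); last first.
  by apply: eq_bigr => j _; rewrite -mulrDl subrK.
rewrite subrr add0r mulr_sumr big_nat_cond [leRHS]big_nat_cond.
apply: ler_sum => j /andP[/andP[dj _] jp].
by rewrite ler_wpM2r ?sqr_ge0// mono.
Unshelve. all: by end_near. Qed.

(* Ky Fan's maximum principle, with a remainder controlled by the gap. *)
Lemma ky_fan_gap (A : H -> H) lambda e f d :
  self_adjoint A -> eigen_decomposition ip p A lambda e ->
  orthonormal_basis ip p f -> (0 < d)%N -> lt_dim d p ->
  (lambda d - lambda d.+1) *
    (d%:R - \sum_(1 <= k < d.+1) \sum_(1 <= j < d.+1) ip (e k) (f j) ^+ 2) <=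
  \sum_(1 <= k < d.+1) ip (e k) (A (e k)) -
  \sum_(1 <= j < d.+1) ip (f j) (A (f j)).
Proof.
move=> Asa Aeig fONB d0 dp; have [eONB Ae mono lge0] := Aeig.
have norm_f j : (1 <= j < d.+1)%N -> `|f j| ^+ 2 = 1.
  move=> /(dim_index_le dp) jp.
  by rewrite -ip_norm (basis_orthonormal fONB)// eqxx.
have sumd (c : R) : \sum_(1 <= j < d.+1) c = c * d%:R.
  by rewrite sumr_const_nat subSS subn0 mulr_natr.
set mu := lambda d.+1.
(* The squared length of the projection of [e k] onto the span of the first [d] vectors of [f], at
   most 1 by Bessel. *)
pose b k := \sum_(1 <= j < d.+1) ip (e k) (f j) ^+ 2.
have b_le1 k : (1 <= k < d.+1)%N -> b k <= 1.
  move=> kd; rewrite /b; under eq_bigr do rewrite ipC.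
  apply: le_trans (bessel (e k) fONB dp) _.
  by rewrite -ip_norm (basis_orthonormal eONB) ?eqxx// (dim_index_le dp).
have le_f : \sum_(1 <= j < d.+1) ip (f j) (A (f j)) <=
    \sum_(1 <= k < d.+1) (lambda k - mu) * b k + mu * d%:R.
  apply: (@le_trans _ _ (\sum_(1 <= j < d.+1)
      (\sum_(1 <= k < d.+1) (lambda k - mu) * ip (e k) (f j) ^+ 2 + mu))).
    apply: ler_sum_nat => j jd.
    have := eigen_quad_le (f j) Asa Aeig d0 dp.
    by rewrite norm_f// mulr1.
  rewrite big_split /= sumd exchange_big /=.
  by rewrite lerD2r ler_sum// => k _; rewrite /b mulr_sumr.
have -> : \sum_(1 <= k < d.+1) ip (e k) (A (e k)) =
          \sum_(1 <= k < d.+1) (lambda k - mu) + mu * d%:R.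
  rewrite -sumd -big_split /=; apply: eq_big_nat => k kd.
  have kp := dim_index_le dp kd.
  by rewrite Ae// ipZr (basis_orthonormal eONB)// eqxx mulr1 subrK.
rewrite lerBrDr; apply: le_trans (lerD (lexx _) le_f) _.
rewrite addrA lerD2r -lerBrDr -sumrB.
rewrite -/mu -[X in _ * (X - _)]mul1r -sumd -sumrB mulr_sumr.
(* Summand by summand, [lambda k - mu] is lowered to [lambda d - mu] against the nonnegative weight
   [1 - b k]. *)
apply: ler_sum_nat => k kd.
rewrite -[X in _ <= X - _]mulr1 -mulrBr ler_wpM2r ?subr_ge0 ?b_le1//.
rewrite lerB// mono//; first exact: (dim_index_le dp).
- by rewrite (dim_index_le dp)// d0/=.
- by case/andP: kd.
Qed.

(** The projection has finite rank: after exchanging the sums, each of the [d] inner series is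
    Parseval's for [f k] and [S (f k)]. No trace-class condition on [S] enters. *)
Lemma cvg_trace_proj S u f d : self_adjoint S -> orthonormal_basis ip p u ->
  \sum_(1 <= m < N.+1 | dim_index p m) ip (S (u m)) (proj_le ip f d (u m))
    @[N --> \oo] --> \sum_(1 <= k < d.+1) ip (f k) (S (f k)).
Proof.
move=> Ssa ONB.
rewrite [X in X @ _ --> _](_ : _ = fun N => \sum_(1 <= k < d.+1)
  \sum_(1 <= m < N.+1 | dim_index p m) ip (u m) (f k) * ip (u m) (S (f k))).
  apply: cvg_big => [|k _]; first exact: add_continuous.
  exact: (basis_parseval ip_norm).
apply/funext => N; rewrite exchange_big /=; apply: eq_bigr => m _.
rewrite /proj_le fct_sumE ip_sumr; apply: eq_bigr => k _.
by rewrite /tensor ipZr Ssa (ipC ip (f k) (u m)).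
Qed.

Arguments cvg_trace_proj {S u} f d Ssa ONB.

Lemma cvg_trace_projB S u f g d : self_adjoint S -> orthonormal_basis ip p u ->
  \sum_(1 <= m < N.+1 | dim_index p m)
      ip (S (u m)) ((proj_le ip f d - proj_le ip g d) (u m))
    @[N --> \oo] -->
  \sum_(1 <= k < d.+1) ip (f k) (S (f k))
  - \sum_(1 <= k < d.+1) ip (g k) (S (g k)).
Proof.
move=> Ssa ONB.
apply: (cvg_trans _
  (cvgB (cvg_trace_proj f d Ssa ONB) (cvg_trace_proj g d Ssa ONB))).
apply: near_eq_cvg; near=> N => /=.
rewrite [LHS]/GRing.add /= -sumrB; apply: eq_bigr => m _.
by rewrite addrfctE opprfctE /= ipBr.
Unshelve. all: by end_near. Qed.

Arguments cvg_trace_projB {S u} f g d Ssa ONB.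

Lemma hs_inner_projB S u f g d : self_adjoint S -> orthonormal_basis ip p u ->
  hs_inner ip p u S (proj_le ip f d - proj_le ip g d) =
  \sum_(1 <= k < d.+1) ip (f k) (S (f k))
  - \sum_(1 <= k < d.+1) ip (g k) (S (g k)).
Proof.
move=> Ssa ONB; rewrite /hs_inner (adjointE Ssa) /trace.
rewrite -(cvg_lim _ (cvg_trace_projB f g d Ssa ONB))//.
by congr (limn _); apply/funext => N; apply: eq_bigr => m _; rewrite Ssa.
Qed.

Lemma proj_le_self_adjoint f d : self_adjoint (proj_le ip f d).
Proof.
move=> x y; rewrite /proj_le !fct_sumE ip_suml ip_sumr; apply: eq_bigr => k _.
by rewrite /tensor ipZl ipZr (ipC ip x) mulrC.
Qed.

Lemma self_adjointB S S' :
  self_adjoint S -> self_adjoint S' -> self_adjoint (S - S').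
Proof. by move=> Ss S's x y; rewrite ipBl ipBr Ss S's. Qed.

Lemma ip_proj_le f d x :
  ip x (proj_le ip f d x) = \sum_(1 <= k < d.+1) ip (f k) x ^+ 2.
Proof.
rewrite /proj_le fct_sumE ip_sumr; apply: eq_bigr => k _.
by rewrite /tensor ipZr ipC (ipC ip x) expr2.
Qed.

(** This is the trace formula with the difference of the projections itself as [S]: the two own
    terms give [d] each, and the two cross terms are the same double sum. *)
Lemma cvg_hs_projB u v d :
  orthonormal_basis ip p u -> orthonormal_basis ip p v -> lt_dim d p ->
  \sum_(1 <= m < N.+1 | dim_index p m)
      ip ((proj_le ip u d - proj_le ip v d) (u m))
         ((proj_le ip u d - proj_le ip v d) (u m))
    @[N --> \oo] -->
  2 * (d%:R - \sum_(1 <= k < d.+1) \sum_(1 <= j < d.+1) ip (u k) (v j) ^+ 2).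
Proof.
move=> uONB vONB dp.
have Dsa := self_adjointB (@proj_le_self_adjoint u d)
  (@proj_le_self_adjoint v d).
have := cvg_trace_projB u v d Dsa uONB.
congr (_ --> _).
have own w : orthonormal_basis ip p w ->
    \sum_(1 <= k < d.+1) ip (w k) (proj_le ip w d (w k)) = d%:R.
  move=> wONB; transitivity (\sum_(1 <= k < d.+1) (1 : R)); last first.
    by rewrite sumr_const_nat subSS subn0.
  apply: eq_big_nat => k kd; rewrite ip_proj_le.
  rewrite (bigD1_seq k) ?iota_uniq ?mem_index_iota//=.
  rewrite (basis_orthonormal wONB) ?(dim_index_le dp)// eqxx expr1n.
  rewrite big_nat_cond big1 ?addr0// => j /andP[jd /negbTE jk].
  by rewrite (basis_orthonormal wONB) ?(dim_index_le dp)// jk expr0n.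
rewrite addrfctE opprfctE /=.
under eq_bigr do rewrite ipBr; under [X in _ - X]eq_bigr do rewrite ipBr.
rewrite !sumrB !own//.
have cross w w' : \sum_(1 <= i < d.+1) ip (w i) (proj_le ip w' d (w i)) =
    \sum_(1 <= i < d.+1) \sum_(1 <= k < d.+1) ip (w' k) (w i) ^+ 2.
  by apply: eq_bigr => i _; rewrite ip_proj_le.
rewrite !cross [X in _ - X - _]exchange_big /=.
under [X in _ - X - _]eq_bigr do under eq_bigr do rewrite ipC.
rewrite [X in _ - X - _]exchange_big /= [X in _ - _ - (X - _)]exchange_big /=.
lra.
Qed.

End operators.

Arguments cvg_trace_proj {R H ip} ip_norm {p S u} f d Ssa ONB.
Arguments cvg_trace_projB {R H ip} ip_norm {p S u} f g d Ssa ONB.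

(** The infimum over [t] of the right-hand side is [2 * a * b]. This turns the family of linear
    bounds back into a product, also when [a] or [b] vanishes. *)
Lemma le_mul_AMGM (R : realType) (E a b : R) : 0 <= a -> 0 <= b ->
  (forall t, 0 < t -> E *+ 2 <= t * a ^+ 2 + t^-1 * b ^+ 2) -> E <= b * a.
Proof.
move=> a0 b0 h; apply/ler_addgt0Pr => eps eps0.
(* The optimal [t = b / a] is perturbed so as to be defined and positive. *)
pose k := a + b + 1; have k0 : 0 < k by rewrite /k; lra.
pose e := eps / k; have e0 : 0 < e by rewrite divr_gt0.
have ae : 0 < a + e by rewrite ltr_wpDl.
have be : 0 < b + e by rewrite ltr_wpDl.
have := h _ (divr_gt0 be ae).
have h1 : (b + e) / (a + e) * a ^+ 2 <= (b + e) * a.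
  rewrite -mulrA (ler_wpM2l (ltW be))// mulrC ler_pdivrMr//.
  by rewrite expr2 ler_wpM2l//; lra.
have h2 : ((b + e) / (a + e))^-1 * b ^+ 2 <= (a + e) * b.
  rewrite invf_div -mulrA (ler_wpM2l (ltW ae))// mulrC ler_pdivrMr//.
  by rewrite expr2 ler_wpM2l//; lra.
have h3 : e * (a + b) <= eps.
  rewrite /e mulrAC ler_pdivrMr// (ler_wpM2l (ltW eps0))// /k; lra.
move=> h4; rewrite -(ler_pMn2r (ltn0Sn 1)).
apply: le_trans h4 _; apply: le_trans (lerD h1 h2) _.
lra.
Qed.

Section deterministic.
Context (R : realType) (H : completeNormedModType R).
Variable ip : {dot H for idfun}.
Hypothesis ip_norm : is_hilbert_norm ip.
Variable p : option nat.

(** Finiteness of the Hilbert-Schmidt norm, stated as a bound on partial sums: these are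
    nondecreasing, so the bound gives convergence, and it is easily stable under sums and
    scaling. *)
Definition hs_summable (u : nat -> H) (S : H -> H) :=
  exists M, forall N,
    \sum_(1 <= m < N.+1 | dim_index p m) `|S (u m)| ^+ 2 <= M.

Lemma hs_summable_cvg u S : hs_summable u S ->
  cvgn (fun N => \sum_(1 <= m < N.+1 | dim_index p m) `|S (u m)| ^+ 2).
Proof. by case=> M SM; apply: index_sum_cvg SM => m _; exact: exprn_ge0. Qed.

Lemma hs_normE u S : self_adjoint ip S -> hs_summable u S ->
  hs_norm ip p u S ^+ 2 =
  limn (fun N => \sum_(1 <= m < N.+1 | dim_index p m) `|S (u m)| ^+ 2).
Proof.
move=> Ssa Ssum.
have hsE : hs_inner ip p u S S =
    limn (fun N => \sum_(1 <= m < N.+1 | dim_index p m) `|S (u m)| ^+ 2).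
  rewrite /hs_inner (adjointE ip_norm Ssa) /trace; congr (limn _).
  by apply/funext => N; apply: eq_bigr => m _; rewrite -ip_norm Ssa.
rewrite /hs_norm sqr_sqrtr hsE// limr_ge//; first exact: hs_summable_cvg.
by apply: nearW => N; rewrite sumr_ge0// => m _; exact: exprn_ge0.
Qed.

Lemma hs_norm_ge0 u S : 0 <= hs_norm ip p u S.
Proof. exact: sqrtr_ge0. Qed.

Lemma hs_summable_tensor u a b : orthonormal_basis ip p u ->
  hs_summable u (tensor ip a b).
Proof.
move=> ONB; exists (`|b| ^+ 2 * `|a| ^+ 2) => N.
apply: (@le_trans _ _ (\sum_(1 <= m < N.+1 | dim_index p m)
    ip (u m) b ^+ 2 * `|a| ^+ 2)).
  apply: ler_sum => m _; rewrite /tensor normrZ exprMn.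
  by rewrite real_normK ?num_real// ipC.
rewrite -mulr_suml ler_wpM2r ?exprn_ge0//; exact: bessel_full.
Qed.

Lemma hs_summableD u S S' : hs_summable u S -> hs_summable u S' ->
  hs_summable u (S + S').
Proof.
move=> [M SM] [M' SM']; exists (2 * M + 2 * M') => N.
apply: (@le_trans _ _ (\sum_(1 <= m < N.+1 | dim_index p m)
    (2 * `|S (u m)| ^+ 2 + 2 * `|S' (u m)| ^+ 2))).
  by apply: ler_sum => m _; exact: normD2_le.
by rewrite big_split/= -!mulr_sumr lerD// ler_pM2l.
Qed.

Lemma hs_summableZ u c S : hs_summable u S -> hs_summable u (c *: S).
Proof.
move=> [M SM]; exists (`|c| ^+ 2 * M) => N.
apply: le_trans (ler_wpM2l (exprn_ge0 _ _) (SM N)) => //.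
rewrite mulr_sumr ler_sum// => m _.
by rewrite [_ (u m)]/GRing.scale/= normrZ exprMn.
Qed.

Lemma hs_summable_sum u (I : Type) (r : seq I) (F : I -> H -> H) :
  (forall i, hs_summable u (F i)) -> hs_summable u (\sum_(i <- r) F i).
Proof.
move=> Fs; apply: (big_ind (hs_summable u)) => //.
- by exists 0 => N; rewrite big1// => m _; rewrite normr0 expr0n.
- exact: hs_summableD.
Qed.

(** Trace class implies Hilbert-Schmidt: each squared eigenvalue is at most
    [lambda 1 * lambda m]. *)
Lemma hs_summable_eigen S lambda u M :
  (forall j, dim_index p j -> 0 <= lambda j) ->
  (forall j, dim_index p j -> lambda j <= lambda 1%N) ->
  orthonormal_basis ip p u ->
  (forall j, dim_index p j -> S (u j) = lambda j *: u j) ->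
  (forall N, \sum_(1 <= m < N.+1 | dim_index p m) lambda m <= M) ->
  hs_summable u S.
Proof.
move=> l0 l1 ONB Su lM; exists (`|lambda 1%N| * M) => N.
apply: le_trans (ler_wpM2l (normr_ge0 _) (lM N)).
rewrite mulr_sumr ler_sum// => m mp.
rewrite Su// normrZ exprMn -[`|u m| ^+ 2]ip_norm (basis_orthonormal ONB)// eqxx.
rewrite mulr1 ger0_norm ?l0// expr2 ler_wpM2r ?l0//.
exact: le_trans (l1 _ mp) (ler_norm _).
Qed.

(* [B] is the squared Hilbert-Schmidt distance between the two projections. *)
Lemma pca_risk_bounds (S Sh : H -> H) lambda lambdah u uh d :
  self_adjoint ip S -> self_adjoint ip Sh ->
  eigen_decomposition ip p S lambda u ->
  eigen_decomposition ip p Sh lambdah uh ->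
  hs_summable u (S - Sh) -> (0 < d)%N -> lt_dim d p ->
  let E := hs_inner ip p u S (proj_le ip u d - proj_le ip uh d) in
  exists B, [/\ 0 <= B, B <= 2 * d%:R,
    (lambda d - lambda d.+1) * B <= E *+ 2 &
    forall t, 0 < t ->
      E *+ 2 <= t * hs_norm ip p u (S - Sh) ^+ 2 + t^-1 * B].
Proof.
move=> Ssa Shsa Seig Sheig Dsum d0 dp E.
have [uONB _ _ _] := Seig; have [uhONB _ _ _] := Sheig.
have Dsa := self_adjointB Ssa Shsa.
pose s := \sum_(1 <= k < d.+1) \sum_(1 <= j < d.+1) ip (u k) (uh j) ^+ 2.
have s0 : 0 <= s.
  by apply: sumr_ge0 => k _; apply: sumr_ge0 => j _; exact: sqr_ge0.
have Bcvg := cvg_hs_projB ip_norm uONB uhONB dp.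
have EE : E = _ := hs_inner_projB ip_norm u uh d Ssa uONB.
have gapE := ky_fan_gap ip_norm Ssa Seig uhONB d0 dp.
have [_ _ hmono _] := Sheig.
have gaph0 : 0 <= lambdah d - lambdah d.+1.
  by rewrite subr_ge0 hmono// (dim_index_le dp)// d0/=.
(* The roles of the bases are exchanged: [uh] is the eigenbasis of [Sh], and [u] is the
   competitor. *)
have := ky_fan_gap ip_norm Shsa Sheig uONB d0 dp.
have sE : \sum_(1 <= k < d.+1) \sum_(1 <= j < d.+1) ip (uh k) (u j) ^+ 2 = s.
  rewrite exchange_big; apply: eq_bigr => k _; apply: eq_bigr => j _.
  by rewrite ipC.
rewrite sE -/s => hE.
have B0 : 0 <= 2 * (d%:R - s).
  apply: (cvgr_to_ge Bcvg); apply: nearW => N.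
  by apply: sumr_ge0 => m _; exact: ip_ge0.
exists (2 * (d%:R - s)); split => //.
- by rewrite ler_pM2l// gerBl.
- by rewrite mulrCA mulr2n -EE -/s in gapE *; lra.
move=> t t0.
have hE0 : 0 <= (lambdah d - lambdah d.+1) * (d%:R - s).
  by rewrite mulr_ge0//; lra.
pose L := \sum_(1 <= k < d.+1) ip (u k) ((S - Sh) (u k)) -
          \sum_(1 <= k < d.+1) ip (uh k) ((S - Sh) (uh k)).
have EL : E <= L.
  rewrite EE /L addrfctE opprfctE /=.
  under [X in _ <= X - _]eq_bigr do rewrite ipBr.
  under [X in _ <= _ - X]eq_bigr do rewrite ipBr.
  rewrite !sumrB; move: (le_trans hE0 hE); lra.
apply: le_trans (_ : L *+ 2 <= _); first by rewrite ler_pMn2r.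
have Lcvg := cvg_trace_projB ip_norm u uh d Dsa uONB.
have Acvg := hs_summable_cvg Dsum.
rewrite hs_normE//.
(* Cauchy-Schwarz for operators is obtained by applying the vector inequality to each basis vector
   [u m] and passing to the limit of the partial sums. *)
rewrite mulr2n; apply: (ler_cvg_to (cvgD Lcvg Lcvg)
  (cvgD (cvgM (cvg_cst t) Acvg) (cvgM (cvg_cst t^-1) Bcvg))).
apply: nearW => N; rewrite [leLHS]/GRing.add [leRHS]/GRing.add /=.
rewrite -big_split /= !mulr_sumr -big_split /= ler_sum// => m _.
by rewrite -mulr2n -ip_norm ip_AMGM.
Qed.

End deterministic.

(** * The covariance operator *)

Section covariance.
Context (R : realType) (H : completeNormedModType R).
Variable ip : {dot H for idfun}.
Hypothesis ip_norm : is_hilbert_norm ip.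
Context (disp : measure_display) (T : measurableType disp).
Variable P : probability T R.

Lemma continuous_measurable_borel (f : H -> R) : continuous f ->
  measurable_fun [set: borel H] (f : borel H -> R).
Proof.
move=> /continuousP cf; apply: (measurability _
  (RGenOpens.measurableE R)).
move=> _ [_ [a [b ->] <-]]; rewrite setTI; apply: sub_sigma_algebra.
by apply: cf; exact: interval_open.
Qed.

Lemma continuous_ip (v : H) : continuous (fun x => ip x v).
Proof. by move=> x; exact: ip_cvgl. Qed.

Section random_vector.
Variable X : {RV P >-> borel H}.

Lemma measurable_ip v : measurable_fun [set: T] (fun w => ip (X w : H) v).
Proof.
apply: (measurableT_comp (f := (fun x => ip x v) : borel H -> R)) => //.
apply: continuous_measurable_borel => x; exact: continuous_ip.
Qed.

Lemma measurable_normX : measurable_fun [set: T] (fun w => `|X w : H|).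
Proof.
apply: (measurableT_comp (f := (fun x : H => `|x|) : borel H -> R)) => //.
apply: continuous_measurable_borel => x; exact: norm_continuous.
Qed.

Hypothesis X_square : ('E_P[fun w => (`|X w : H| ^+ 2)%R] < +oo)%E.

Lemma integrable_normX2 :
  P.-integrable [set: T] (EFin \o (fun w => `|X w : H| ^+ 2)).
Proof.
apply/integrableP; split.
  apply/measurable_EFinP; apply: measurable_funX; exact: measurable_normX.
move: X_square; rewrite unlock; apply: le_lt_trans.
rewrite le_eqVlt; apply/orP; left; apply/eqP; apply: eq_integral => w _ /=.
by rewrite ger0_norm// exprn_ge0.
Qed.

Lemma integrable_cov x v :
  P.-integrable [set: T] (EFin \o (fun w => ip (X w : H) x * ip (X w : H) v)).
Proof.
apply: (@le_integrable _ _ _ _ _ measurableT _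
   (EFin \o (fun w => (`|x| * `|v|) * `|X w : H| ^+ 2))).
- by apply/measurable_EFinP; apply: measurable_funM; exact: measurable_ip.
- move=> w _ /=; rewrite lee_fin normrM [leRHS]ger0_norm ?mulr_ge0 ?exprn_ge0//.
  rewrite expr2 mulrACA (mulrC `|x|) (mulrC `|v|).
  by apply: ler_pM => //; exact: ip_CauchySchwarz.
- rewrite [X in integrable _ _ X](_ : _ = fun w =>
    ((`|x| * `|v|)%R%:E * (`|X w : H| ^+ 2)%R%:E)%E)//.
  by apply: integrableZl => //; exact: integrable_normX2.
Qed.

(** The covariance form, defined independently of the chosen operator, which is later shown to
    represent it. *)
Definition cov (x v : H) := \int[P]_w (ip (X w : H) x * ip (X w : H) v).

Lemma expectation_cov x v :
  ('E_P[fun w => (ip (X w : H) x * ip (X w : H) v)%R] = (cov x v)%:E)%E.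
Proof.
rewrite unlock /cov /Rintegral fineK//.
exact: integrable_fin_num (integrable_cov x v).
Qed.

Lemma covC x v : cov x v = cov v x.
Proof. by apply: eq_Rintegral => w _; rewrite mulrC. Qed.

Lemma covDl x y v : cov (x + y) v = cov x v + cov y v.
Proof.
rewrite /cov -RintegralD//; try exact: integrable_cov.
by apply: eq_Rintegral => w _; rewrite ipDr mulrDl.
Qed.

Lemma covZl a x v : cov (a *: x) v = a * cov x v.
Proof.
rewrite /cov -RintegralZl//; last exact: integrable_cov.
by apply: eq_Rintegral => w _; rewrite ipZr mulrA.
Qed.

Lemma covBl x y v : cov (x - y) v = cov x v - cov y v.
Proof. by rewrite covDl -[- y]scaleN1r covZl mulN1r. Qed.

Definition second_moment := \int[P]_w (`|X w : H| ^+ 2).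

Lemma second_moment_ge0 : 0 <= second_moment.
Proof. by apply: Rintegral_ge0 => w _; exact: exprn_ge0. Qed.

Lemma cov_le x v : `|cov x v| <= second_moment * `|x| * `|v|.
Proof.
apply: le_trans (le_normr_Rintegral _ (integrable_cov x v)) _ => //.
rewrite -mulrA mulrC -RintegralZl//; last exact: integrable_normX2.
apply: le_Rintegral => //.
- rewrite [X in integrable _ _ X](_ : _ = fun w =>
    `|(ip (X w : H) x * ip (X w : H) v)%R%:E|%E); last by [].
  by apply: integrable_abse; exact: integrable_cov.
- rewrite [X in integrable _ _ X](_ : _ = fun w =>
    ((`|x| * `|v|)%R%:E * (`|X w : H| ^+ 2)%R%:E)%E)//.
  by apply: integrableZl => //; exact: integrable_normX2.
move=> w _; rewrite normrM expr2 mulrACA (mulrC `|x|) (mulrC `|v|).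
by apply: ler_pM => //; exact: ip_CauchySchwarz.
Qed.

Lemma cov_sum (I : Type) (r : seq I) (Q : pred I) (F : I -> H) v :
  cov (\sum_(i <- r | Q i) F i) v = \sum_(i <- r | Q i) cov (F i) v.
Proof.
apply: (big_morph (fun x => cov x v)) => [x y|]; first exact: covDl.
by rewrite -(scale0r (0 : H)) covZl mul0r.
Qed.

Lemma sum_cov_le p u N : orthonormal_basis ip p u ->
  \sum_(1 <= j < N.+1 | dim_index p j) cov (u j) (u j) <= second_moment.
Proof.
move=> ONB.
(* Integrability and the exchange of sum and integral are proved in one induction, as additivity at
   each step requires integrability of the tail. *)
have [f_int ->] : P.-integrable [set: T] (EFin \o (fun w =>
      \sum_(1 <= j < N.+1 | dim_index p j) ip (u j) (X w) ^+ 2)) /\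
    \sum_(1 <= j < N.+1 | dim_index p j) cov (u j) (u j) =
    \int[P]_w \sum_(1 <= j < N.+1 | dim_index p j) ip (u j) (X w) ^+ 2.
  elim: (index_iota _ _) => [|j s [s_int IH]].
    have -> : (fun w => \sum_(j <- [::] | dim_index p j) ip (u j) (X w) ^+ 2) =
        cst (0 : R) by apply/funext => w; rewrite big_nil.
    rewrite big_nil Rintegral_cst// mul0r; split => //.
    exact: finite_measure_integrable_cst.
  rewrite big_cons; have [jp|jp] := boolP (dim_index p j); last first.
    have -> // : (fun w => \sum_(i <- j :: s | dim_index p i)
        ip (u i) (X w) ^+ 2) =
      (fun w => \sum_(i <- s | dim_index p i) ip (u i) (X w) ^+ 2).
    by apply/funext => w; rewrite big_cons (negbTE jp).
  have -> : (fun w => \sum_(i <- j :: s | dim_index p i)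
      ip (u i) (X w) ^+ 2) = (fun w => ip (X w : H) (u j) * ip (X w : H) (u j) +
    \sum_(i <- s | dim_index p i) ip (u i) (X w) ^+ 2).
    by apply/funext => w; rewrite big_cons jp expr2 ipC.
  have j_int := integrable_cov (u j) (u j).
  split; first exact: (integrableD measurableT j_int s_int).
  by rewrite RintegralD// IH.
apply: le_Rintegral => //; first exact: integrable_normX2.
by move=> w _; exact: bessel_full.
Qed.

Lemma covariance_operatorE_ex x :
  (exists m,
    is_expectation ip P (fun w => tensor ip (X w : H) (X w : H) x) m) ->
  forall v, ip (covariance_operator ip P X x) v = cov x v.
Proof.
move=> /(xgetPex 0) + v => /(_ v).
rewrite -/(covariance_operator ip P X x) => h.
apply/EFin_inj; rewrite -h -expectation_cov; congr expectation.
by apply/funext => w; rewrite /tensor ipZl.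
Qed.

Section eigen.
Variables (p : option nat) (lambda : nat -> R) (u : nat -> H).
Hypothesis Sigma_eigen :
  eigen_decomposition ip p (covariance_operator ip P X) lambda u.
Hypothesis lambda_gt0 : forall j, dim_index p j -> 0 < lambda j.

(** If no weak expectation existed at [u j], the default value would give [lambda j *: u j = 0],
    impossible for a positive eigenvalue and a unit vector. *)
Lemma cov_eigen j v : dim_index p j -> cov (u j) v = lambda j * ip (u j) v.
Proof.
move=> jp; have [ONB Su _ _] := Sigma_eigen.
rewrite -ipZl -Su// covariance_operatorE_ex//.
apply: contrapT => noex.
have : covariance_operator ip P X (u j) = 0.
  by apply: xgetPN => m mE; apply: noex; exists m.
rewrite Su// => /eqP; rewrite scaler_eq0 gt_eqF ?lambda_gt0//= => /eqP uj0.
have := basis_orthonormal ONB jp jp; rewrite uj0 ip0l eqxx => /eqP.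
by rewrite eq_sym oner_eq0.
Qed.

Lemma cov_continuous_l v : continuous (cov^~ v).
Proof.
have c_lip (x y : H) : `|cov x v - cov y v| <= second_moment * `|v| * `|x - y|.
  by rewrite -covBl mulrAC cov_le.
have k1 : 0 < second_moment * `|v| + 1.
  by rewrite ltr_wpDl// mulr_ge0// second_moment_ge0.
move=> x; apply/cvgrPdist_le => e e0.
near=> y; apply: (le_trans (c_lip _ _)).
apply: (@le_trans _ _ ((second_moment * `|v| + 1) * `|x - y|)).
  by rewrite ler_wpM2r// lerDl.
rewrite mulrC -ler_pdivlMr//; near: y.
by apply: (@cvgr_dist_le _ _ _ _ _ id x (@cvg_id _ _)); rewrite divr_gt0.
Unshelve. all: by end_near. Qed.

(** The weak expectation at [x] is built as the limit of its values on the partial expansions of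
    [x], where the eigenvector case applies; continuity of [cov] identifies the limit. *)
Lemma covariance_operatorE x v : ip (covariance_operator ip P X x) v = cov x v.
Proof.
apply: covariance_operatorE_ex.
have [ONB Su _ _] := Sigma_eigen.
pose xs N := \sum_(1 <= j < N.+1 | dim_index p j) ip (u j) x *: u j.
pose ys N := \sum_(1 <= j < N.+1 | dim_index p j)
  ip (u j) x *: (lambda j *: u j).
have xs_cvg : xs @ \oo --> x by have [_] := ONB; apply.
have cov_xs N z : cov (xs N) z = ip (ys N) z.
  rewrite cov_sum ip_suml; apply: eq_bigr => j jp.
  by rewrite covZl cov_eigen// !ipZl.
(* The partial sums [ys] of [Sigma x] are Cauchy because those of [x] are. *)
have ys_lip M N : `|ys M - ys N| <= second_moment * `|xs M - xs N|.
  have [->|yMN0] := eqVneq (ys M - ys N) 0.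
    by rewrite normr0 mulr_ge0// second_moment_ge0.
  rewrite -(@ler_pM2r _ `|ys M - ys N|) ?normr_gt0//.
  rewrite -expr2 -ip_norm ipBl -!cov_xs -covBl.
  exact: le_trans (ler_norm _) (cov_le _ _).
have ys_cvg : cvgn ys.
  apply/cauchy_cvgP/cauchy_exP => e e0.
  (* The 2 comes from the triangle inequality through [x]; the added 1 keeps the denominator
     positive and the final inequality strict. *)
  have m1 : 0 < second_moment *+ 2 + 1.
    by rewrite ltr_wpDl// mulrn_wge0// second_moment_ge0.
  have /cvgrPdist_lt /(_ _ (divr_gt0 e0 m1)) [N _ xsN] := xs_cvg.
  exists (ys N); exists N => // n /= Nn; rewrite -ball_normE /=.
  apply: le_lt_trans (ys_lip N n) _.
  apply: (@le_lt_trans _ _ (second_moment *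
      (e / (second_moment *+ 2 + 1) *+ 2))).
    apply: ler_wpM2l; first exact: second_moment_ge0.
    apply: le_trans (ler_distD x _ _) _.
    by rewrite mulr2n distrC lerD// ltW// xsN/=.
  rewrite -[ltRHS](divfK (lt0r_neq0 m1)).
  have -> : e / (second_moment *+ 2 + 1) * (second_moment *+ 2 + 1) =
      second_moment * (e / (second_moment *+ 2 + 1) *+ 2) +
      e / (second_moment *+ 2 + 1) by ring.
  by rewrite ltrDl divr_gt0.
exists (limn ys) => z.
have -> : (fun w => ip (tensor ip (X w : H) (X w : H) x) z) =
          (fun w => ip (X w : H) x * ip (X w : H) z).
  by apply/funext => w; rewrite /tensor ipZl.
rewrite expectation_cov; congr EFin.
have cov_cvg : cov (xs N) z @[N --> \oo] --> cov x z.
  apply: (continuous_cvg _ (h := fun y => cov y z)) xs_cvg.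
  exact: cov_continuous_l.
have ip_cvg : cov (xs N) z @[N --> \oo] --> ip (limn ys) z.
  by under eq_fun do rewrite cov_xs; exact: (ip_cvgl ip_norm).
by rewrite -(cvg_lim (@Rhausdorff R) cov_cvg) -(cvg_lim (@Rhausdorff R) ip_cvg).
Unshelve. all: by end_near. Qed.

Lemma covariance_self_adjoint : self_adjoint ip (covariance_operator ip P X).
Proof.
by move=> x y; rewrite covariance_operatorE ipC covariance_operatorE covC.
Qed.

Lemma sum_eigenvalues_le N :
  \sum_(1 <= j < N.+1 | dim_index p j) lambda j <= second_moment.
Proof.
have [ONB _ _ _] := Sigma_eigen; apply: le_trans (sum_cov_le N ONB).
apply: ler_sum => j jp.
by rewrite cov_eigen// (basis_orthonormal ONB)// eqxx mulr1.
Qed.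

(** The [limn] in [trace] dominates its nondecreasing partial sums once they converge, which the
    bound by the second moment ensures. *)
Lemma sum_eigenvalues_le_trace N :
  \sum_(1 <= j < N.+1 | dim_index p j) lambda j <=
  trace ip p u (covariance_operator ip P X).
Proof.
have [ONB Su _ l0] := Sigma_eigen.
have -> : trace ip p u (covariance_operator ip P X) =
    limn (fun N => \sum_(1 <= j < N.+1 | dim_index p j) lambda j).
  congr (limn _); apply/funext => M; apply: eq_bigr => j jp.
  by rewrite Su// ipZr (basis_orthonormal ONB)// eqxx mulr1.
apply: (nondecreasing_cvgn_le (index_sum_nd l0)).
exact: (index_sum_cvg l0 sum_eigenvalues_le).
Qed.

End eigen.
End random_vector.
End covariance.

(** * Expectation of the Hilbert-Schmidt norm *)

Section integral_bounds.
Context (R : realType) (disp : measure_display) (T : measurableType disp).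
Variable P : probability T R.

(* The integral of a nonnegative function is a supremum over simple functions
   below it, so that monotonicity does not require measurability. *)
Lemma le_integral_nonmeasurable (f g : T -> \bar R) :
  (forall w, 0 <= f w)%E -> (forall w, f w <= g w)%E ->
  (\int[P]_w f w <= \int[P]_w g w)%E.
Proof.
move=> f0 fg; have g0 w : (0 <= g w)%E by exact: le_trans (fg w).
rewrite !ge0_integralTE//; apply: ereal_sup_le => _ [h /= hf <-].
by exists h => // w; exact: le_trans (hf w) (fg w).
Qed.

Lemma integral_nd_cvg_le (f : nat -> T -> R) (g : T -> R) (M : R) :
  (forall N, measurable_fun [set: T] (f N)) ->
  (forall N w, 0 <= f N w) ->
  (forall w, nondecreasing_seq (f ^~ w)) ->
  (forall w, f ^~ w @ \oo --> g w) ->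
  (forall N, \int[P]_w (f N w)%:E <= M%:E)%E ->
  (\int[P]_w (g w)%:E <= M%:E)%E.
Proof.
move=> mf f0 nd fg fM.
rewrite (_ : (\int[P]_w (g w)%:E)%E =
    limn (fun N => \int[P]_w (f N w)%:E)%E); last first.
  rewrite -monotone_convergence//.
  - apply: eq_integral => w _; apply/esym/cvg_lim => //.
    exact: (cvg_comp _ _ (fg w)).
  - by move=> N; exact/measurable_EFinP.
  - by move=> N w _; rewrite lee_fin f0.
  - by move=> w _ m N mN; rewrite lee_fin nd.
apply: lime_le; last exact: nearW.
apply: ereal_nondecreasing_is_cvgn => m N mN; apply: ge0_le_integral => //.
- by move=> w _; rewrite lee_fin.
- exact/measurable_EFinP.
- exact/measurable_EFinP.
- by move=> w _; rewrite lee_fin nd.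
Qed.

Lemma ge0_integral_EFin_sum (I : Type) (s : seq I) (Q : pred I)
    (f : I -> T -> R) :
  (forall i, measurable_fun [set: T] (f i)) ->
  (forall i w, 0 <= f i w) ->
  (\int[P]_w (\sum_(i <- s | Q i) f i w)%R%:E =
   \sum_(i <- s | Q i) \int[P]_w (f i w)%:E)%E.
Proof.
move=> mf f0; rewrite -big_filter -ge0_integral_sum//.
- by apply: eq_integral => w _; rewrite -big_filter sumEFin.
- by move=> i; exact/measurable_EFinP.
- by move=> i w _; rewrite lee_fin.
Qed.

End integral_bounds.

(** * Rank-one blocks of an operator *)

Section sandwich.
Context (R : realType) (H : completeNormedModType R).
Variable ip : {dot H for idfun}.
Hypothesis ip_norm : is_hilbert_norm ip.

Lemma hs_norm_tensor p u a b : orthonormal_basis ip p u ->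
  hs_norm ip p u (tensor ip a b) ^+ 2 = `|a| ^+ 2 * `|b| ^+ 2.
Proof.
move=> ONB; rewrite /hs_norm.
have -> : hs_inner ip p u (tensor ip a b) (tensor ip a b) =
    `|a| ^+ 2 * `|b| ^+ 2.
  rewrite /hs_inner (adjointE ip_norm (S' := tensor ip b a)); last first.
    by move=> x y; rewrite /tensor ipZl ipZr (ipC ip b) mulrC.
  rewrite -!ip_norm; apply: cvg_lim => //.
  have := basis_parseval ip_norm ONB b b.
  move=> /(cvgM (cvg_cst (ip a a))).
  apply: cvg_trans; apply: near_eq_cvg; near=> N.
  rewrite /= mulr_sumr; apply: eq_bigr => j _.
  by rewrite /tensor !ipZr (ipC ip b) mulrCA mulrA.
by rewrite sqr_sqrtr// mulr_ge0 ?exprn_ge0.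
Unshelve. all: by end_near. Qed.

(** The sandwiched operator is the rank-one tensor of [u j] and [u k] scaled by a matrix entry of
    [S]; the constraints defining [smallest_C2] thus become constraints on scalars. *)
Lemma hs_norm_sandwich p u (S : H -> H) j k : self_adjoint ip S ->
  orthonormal_basis ip p u -> dim_index p j -> dim_index p k ->
  hs_norm ip p u (tensor ip (u j) (u j) \o S \o tensor ip (u k) (u k)) ^+ 2 =
  ip (u j) (S (u k)) ^+ 2.
Proof.
move=> Ssa ONB jp kp.
have norm1 i : dim_index p i -> `|u i| ^+ 2 = 1.
  by move=> ip_; rewrite -ip_norm (basis_orthonormal ONB)// eqxx.
have -> : tensor ip (u j) (u j) \o S \o tensor ip (u k) (u k) =
    tensor ip (ip (u j) (S (u k)) *: u j) (u k).
  apply/funext => x; rewrite /tensor /= -Ssa ipZr Ssa.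
  by rewrite scalerA.
rewrite hs_norm_tensor// norm1// mulr1 normrZ exprMn norm1// mulr1.
by rewrite real_normK ?num_real.
Qed.

End sandwich.

Section empirical.
Context (R : realType) (H : completeNormedModType R).
Variable ip : {dot H for idfun}.
Hypothesis ip_norm : is_hilbert_norm ip.
Context (disp : measure_display) (T : measurableType disp).
Variables (n : nat) (Xs : 'I_n -> T -> H).

Lemma empirical_covarianceE w x y : ip (empirical_covariance ip Xs w x) y =
  n%:R^-1 * \sum_(i < n) ip (Xs i w) x * ip (Xs i w) y.
Proof.
rewrite /empirical_covariance [_ x]/GRing.scale/= fct_sumE ipZl ip_suml.
by congr (_ * _); apply: eq_bigr => i _; rewrite /tensor ipZl.
Qed.

Lemma empirical_self_adjoint w : self_adjoint ip (empirical_covariance ip Xs w).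
Proof.
move=> x y; rewrite empirical_covarianceE ipC empirical_covarianceE.
by congr (_ * _); apply: eq_bigr => i _; rewrite mulrC.
Qed.

Lemma hs_summable_empirical p u w : orthonormal_basis ip p u ->
  hs_summable p u (empirical_covariance ip Xs w).
Proof.
move=> ONB; apply: hs_summableZ; apply: hs_summable_sum => // i.
exact: hs_summable_tensor.
Qed.

End empirical.

(** * Fourth moments and transfer between copies *)

Section sub_gaussian_moments.
Context (R : realType) (H : completeNormedModType R).
Variable ip : {dot H for idfun}.
Context (disp : measure_display) (T : measurableType disp).
Variable P : probability T R.

(** The case [k = 4] of the supremum, raised to the fourth power: the factor [k ^ (-1/2)] becomes
    [1/16], whence the constant 16. *)
Lemma sub_gaussian_fourth (X : T -> H) (C1 s : R) (v : H) :
  sub_gaussian ip P X C1 -> 0 <= s ->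
  ('E_P[fun w => (ip (X w) v ^+ 2)%R] = s%:E)%E ->
  ('E_P[fun w => (ip (X w) v ^+ 4)%R] <= (16 * C1 ^+ 4 * s ^+ 2)%:E)%E.
Proof.
move=> [_ /(_ v)] sup_le s0 E2.
have := le_trans (ereal_sup_ubound _) sup_le.
move=> /(_ _ (ex_intro2 _ _ 4%N isT erefl)).
rewrite E2 poweR_EFin.
have -> : (fun w => `|ip (X w) v| ^+ 4) = (fun w => ip (X w) v ^+ 4).
  apply/funext => w; rewrite -normrX ger0_norm//.
  by rewrite (exprM _ 2 2) exprn_ge0// sqr_ge0.
have : (0 <= 'E_P[fun w => (ip (X w) v ^+ 4)%R])%E.
  by apply: expectation_ge0 => w; rewrite (exprM _ 2 2) exprn_ge0// sqr_ge0.
have four_gt0 : 0 < (4 : R) `^ (- 2^-1) by rewrite powR_gt0.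
case: ('E_P[fun w => (ip (X w) v ^+ 4)%R])%E => [r||] //.
- rewrite poweR_EFin -!EFinM !lee_fin => r0 h.
  (* The sign of [C1] is unknown; the right-hand side is nonnegative because it dominates the
     left-hand one. *)
  have := lerXn2r 4 _ _ h; rewrite !nnegrE.
  have lhs0 : 0 <= (4 : R) `^ (- 2^-1) * r `^ 4^-1.
    by rewrite mulr_ge0// ?powR_ge0.
  move=> /(_ lhs0 (le_trans lhs0 h)).
  have pw (x y : R) : (x `^ y) ^+ 4 = x `^ (y * 4).
    by rewrite powRrM powR_mulrn ?powR_ge0.
  rewrite !exprMn !pw.
  have -> : (- 2^-1 : R) * 4 = - 2 by lra.
  have -> : (4^-1 : R) * 4 = 1 by lra.
  have -> : (2^-1 : R) * 4 = 2 by lra.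
  rewrite powRr1// powR_invn// powR_mulrn// => h4.
  rewrite -(@ler_pM2l _ (4 ^- 2)) ?invr_gt0 ?exprn_gt0//.
  apply: le_trans h4 _.
  by rewrite le_eqVlt; apply/orP; left; apply/eqP; field.
(* An infinite fourth moment would make the left-hand side infinite while the right-hand side is
   finite. *)
- move=> _; rewrite poweRyr ?invr_neq0//.
  by rewrite gt0_muley ?lte_fin// leye_eq.
Qed.

Lemma expectation_copy (X Y : {RV P >-> borel H}) (g : H -> R) :
  (forall B : set (borel H), measurable B -> P (Y @^-1` B) = P (X @^-1` B)) ->
  continuous g -> (forall x, 0 <= g x) ->
  (\int[P]_w (g (Y w))%:E = \int[P]_w (g (X w))%:E)%E.
Proof.
move=> XY cg g0.
have mg : measurable_fun [set: borel H] (fun x : borel H => (g x)%:E).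
  by apply/measurable_EFinP; exact: continuous_measurable_borel.
have g0' (y : borel H) : (0 <= (g y)%:E)%E by rewrite lee_fin.
transitivity (\int[distribution P Y]_y (g y)%:E)%E.
  by rewrite ge0_integral_distribution.
transitivity (\int[distribution P X]_y (g y)%:E)%E; last first.
  by rewrite ge0_integral_distribution.
by apply: eq_measure_integral => A mA _; exact: XY.
Qed.

End sub_gaussian_moments.

Lemma sqr_sum_le (R : realType) (n : nat) (z : 'I_n -> R) :
  (\sum_(i < n) z i) ^+ 2 <= n%:R * \sum_(i < n) z i ^+ 2.
Proof.
rewrite expr2 big_distrlr /=.
apply: (@le_trans _ _ (\sum_(i < n) \sum_(j < n)
    (2^-1 * z i ^+ 2 + 2^-1 * z j ^+ 2))).
  apply: ler_sum => i _; apply: ler_sum => j _.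
  by have := sqr_ge0 (z i - z j); rewrite sqrrB; lra.
have -> : \sum_(i < n) \sum_(j < n) (2^-1 * z i ^+ 2 + 2^-1 * z j ^+ 2) =
    \sum_(i < n) (n%:R * (2^-1 * z i ^+ 2) + 2^-1 * \sum_(j < n) z j ^+ 2).
  apply: eq_bigr => i _.
  by rewrite big_split /= sumr_const card_ord mulr_natl -mulr_sumr.
rewrite big_split /= sumr_const card_ord -!mulr_sumr -mulr_natl.
by rewrite le_eqVlt; apply/orP; left; apply/eqP; field.
Qed.

(** * Matrix entries of [Delta] and the constant [C2] *)

Section pca.
Context (R : realType) (H : completeNormedModType R).
Variable ip : {dot H for idfun}.
Hypothesis ip_norm : is_hilbert_norm ip.
Variable p : option nat.
Context (disp : measure_display) (T : measurableType disp).
Variable P : probability T R.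
Variable X : {RV P >-> borel H}.
Hypothesis X_square : ('E_P[fun w => (`|X w : H| ^+ 2)%R] < +oo)%E.
Variables (lambda : nat -> R) (u : nat -> H).
Hypothesis Sigma_eigen :
  eigen_decomposition ip p (covariance_operator ip P X) lambda u.
Hypothesis lambda_gt0 : forall j, dim_index p j -> 0 < lambda j.
Variables (n : nat) (Xs : 'I_n -> {RV P >-> borel H}).
Hypothesis n_ge1 : (1 <= n)%N.
Hypothesis Xs_copies : forall (i : 'I_n) (B : set (borel H)), measurable B ->
  P (Xs i @^-1` B) = P (X @^-1` B).

Let Sigma := covariance_operator ip P X.
Let Delta w := Sigma - empirical_covariance ip Xs w.
Let C2 := smallest_C2 ip P p lambda u X Xs.
Let delta (j k : nat) : R := if j == k then 2 else 1.

Let ONB : orthonormal_basis ip p u.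
Proof. by case: Sigma_eigen. Qed.

Let n_gt0 : 0 < n%:R :> R.
Proof. by rewrite ltr0n. Qed.

Lemma Delta_self_adjoint w : self_adjoint ip (Delta w).
Proof.
apply: self_adjointB; last exact: empirical_self_adjoint.
exact: (covariance_self_adjoint ip_norm X_square Sigma_eigen lambda_gt0).
Qed.

Lemma Delta_hs_summable w : hs_summable p u (Delta w).
Proof.
apply: hs_summableD => //.
  have [_ Su mono l0] := Sigma_eigen.
  apply: (hs_summable_eigen ip_norm l0 _ ONB Su
    (sum_eigenvalues_le ip_norm X_square Sigma_eigen lambda_gt0)).
  move=> j jp; have /andP[j0 _] := jp; apply: mono => //.
  by rewrite /dim_index/=; case: p jp => //= m /andP[_]; apply: leq_ltn_trans.
rewrite -scaleN1r; apply: hs_summableZ.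
exact: hs_summable_empirical.
Qed.

Lemma DeltaE j k w : dim_index p j -> dim_index p k ->
  ip (u j) (Delta w (u k)) = lambda k * (j == k)%:R -
    n%:R^-1 * \sum_(i < n) ip (Xs i w : H) (u k) * ip (Xs i w : H) (u j).
Proof.
move=> jp kp; have [_ Su _ _] := Sigma_eigen.
rewrite /Delta addrfctE opprfctE /= ipBr /Sigma Su// ipZr.
by rewrite (basis_orthonormal ONB)// ipC empirical_covarianceE.
Qed.

Lemma measurable_Delta j k : dim_index p j -> dim_index p k ->
  measurable_fun [set: T] (fun w => ip (u j) (Delta w (u k))).
Proof.
move=> jp kp; under eq_fun do rewrite DeltaE//.
apply: measurable_funB => //; apply: measurable_funM => //.
apply: measurable_sum => i.
by apply: measurable_funM; exact: measurable_ip.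
Qed.

Lemma expectation_eigen j : dim_index p j ->
  ('E_P[fun w => (ip (X w : H) (u j) ^+ 2)%R] = (lambda j)%:E)%E.
Proof.
move=> jp; have := expectation_cov ip_norm X_square (u j) (u j).
rewrite (cov_eigen ip_norm X_square Sigma_eigen lambda_gt0)//.
rewrite (basis_orthonormal ONB)// eqxx mulr1 => <-.
by congr expectation; apply/funext => w; rewrite expr2.
Qed.

(* The constant is crude, but it only serves to show that the infimum defining
   [C2] is over a nonempty set, hence is not the junk value [0]. *)
Lemma admissible_constant C1 : sub_gaussian ip P X C1 ->
  forall j k, dim_index p j -> dim_index p k ->
  ('E_P[fun w => (ip (u j) (Delta w (u k)) ^+ 2)%R] <=
    (n%:R * (2 + 2 * (16 * C1 ^+ 4)) * delta j k * lambda j * lambda k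
     / n%:R)%:E)%E.
Proof.
move=> sG j k jp kp.
set M := 16 * C1 ^+ 4.
have M0 : 0 <= M by rewrite mulr_ge0// (exprM _ 2 2) exprn_ge0// sqr_ge0.
have lj := lambda_gt0 jp; have lk := lambda_gt0 kp.
(* The weight balances Young's inequality [2 A^2 B^2 <= r A^4 + B^4 / r]: the fourth moments are of
   order [lambda j ^+ 2] and [lambda k ^+ 2], so both terms have order [lambda j * lambda k]. *)
pose r := lambda k / lambda j.
have r0 : 0 < r by rewrite divr_gt0.
pose g l (x : H) := ip x (u l) ^+ 4.
have g0 l x : 0 <= g l x by rewrite /g (exprM _ 2 2) exprn_ge0// sqr_ge0.
have cg l : continuous (g l).
  move=> x.
  have ip_cvg : ip y (u l) @[y --> x] --> ip x (u l) by exact: continuous_ip.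
  have pow_cvg : y ^+ 4 @[y --> ip x (u l)] --> g l x.
    exact: exprn_continuous.
  exact: (cvg_comp _ _ ip_cvg pow_cvg).
have mg l i : measurable_fun [set: T] (fun w => g l (Xs i w)).
  by apply: measurable_funX; exact: measurable_ip.
have Eg l i : dim_index p l ->
    (\int[P]_w (g l (Xs i w))%:E <= (M * lambda l ^+ 2)%:E)%E.
  move=> lp; rewrite (expectation_copy (Xs_copies i) (cg l) (g0 l)).
  have := sub_gaussian_fourth sG (ltW (lambda_gt0 lp)) (expectation_eigen lp).
  by rewrite unlock.
have EZ c l i : 0 <= c -> (\int[P]_w (c * g l (Xs i w))%:E =
    c%:E * \int[P]_w (g l (Xs i w))%:E)%E.
  move=> c0; under eq_integral do rewrite EFinM.
  rewrite ge0_integralZl//; first by apply/measurable_EFinP; exact: mg.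
  by move=> w _; rewrite lee_fin g0.
pose h i w := n%:R^-1 * (r * g j (Xs i w) + r^-1 * g k (Xs i w)).
have h0 i w : 0 <= h i w.
  rewrite mulr_ge0 ?invr_ge0 ?ler0n// addr_ge0//.
    by rewrite mulr_ge0 ?(ltW r0).
  by rewrite mulr_ge0 ?invr_ge0 ?(ltW r0).
have mh i : measurable_fun [set: T] (h i).
  by apply: measurable_funM => //; apply: measurable_funD;
    apply: measurable_funM.
have Eh i : (\int[P]_w (h i w)%:E <=
    (n%:R^-1 * (2 * M * (lambda j * lambda k)))%:E)%E.
  under eq_integral do rewrite EFinM.
  rewrite ge0_integralZl//; last 2 first.
  - by apply/measurable_EFinP; apply: measurable_funD; apply: measurable_funM.
  - by move=> w _; rewrite lee_fin addr_ge0// mulr_ge0 ?invr_ge0 ?(ltW r0).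
  rewrite EFinM lee_pmul2l ?lte_fin ?invr_gt0//.
  under eq_integral do rewrite EFinD.
  rewrite ge0_integralD//; last 4 first.
  - by move=> w _; rewrite lee_fin mulr_ge0 ?(ltW r0).
  - by apply/measurable_EFinP; apply: measurable_funM.
  - by move=> w _; rewrite lee_fin mulr_ge0 ?invr_ge0 ?(ltW r0).
  - by apply/measurable_EFinP; apply: measurable_funM.
  rewrite !EZ ?invr_ge0 ?(ltW r0)//.
  apply: (@le_trans _ _ (r%:E * (M * lambda j ^+ 2)%R%:E +
      r^-1%:E * (M * lambda k ^+ 2)%R%:E)%E).
    by apply: leeD; apply: lee_wpmul2l; rewrite ?lee_fin ?invr_ge0 ?(ltW r0)//;
      exact: Eg.
  rewrite -!EFinM -EFinD lee_fin /r.
  rewrite le_eqVlt; apply/orP; left; apply/eqP; field.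
  by rewrite !lt0r_neq0.
(* The square of [a - b] is at most [2 a^2 + 2 b^2], for the population entry [a] and the empirical
   entry [b]; the average in [b] is handled by [sqr_sum_le] and Young's inequality. *)
have le_h w : ip (u j) (Delta w (u k)) ^+ 2 <=
    2 * (lambda j * lambda k) + \sum_(i < n) h i w.
  rewrite DeltaE//; set a := lambda k * _; set b := n%:R^-1 * _.
  have a_le : a ^+ 2 <= lambda j * lambda k.
    rewrite /a; have [->|_] := eqVneq j k; first by rewrite mulr1 expr2.
    by rewrite mulr0 expr0n/= mulr_ge0// ltW.
  have b_le : 2 * b ^+ 2 <= \sum_(i < n) h i w.
    apply: (@le_trans _ _ (2 * (n%:R^-1 * \sum_(i < n)
        (ip (Xs i w : H) (u k) * ip (Xs i w : H) (u j)) ^+ 2))).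
      rewrite ler_pM2l// /b exprMn expr2 -mulrA ler_pM2l ?invr_gt0//.
      rewrite mulrC ler_pdivrMr// mulrC; exact: sqr_sum_le.
    rewrite !mulr_sumr; apply: ler_sum => i _.
    rewrite mulrCA /h ler_pM2l ?invr_gt0// /g.
    set A := ip _ (u j); set B := ip _ (u k).
    have -> : r * A ^+ 4 = (r * A ^+ 2) ^+ 2 / r by field; exact: lt0r_neq0.
    have -> : r^-1 * B ^+ 4 = (B ^+ 2) ^+ 2 / r by field; exact: lt0r_neq0.
    rewrite -mulrDl ler_pdivlMr//.
    have := sqr_ge0 (r * A ^+ 2 - B ^+ 2); rewrite -subr_ge0 => h1.
    rewrite -subr_ge0; apply: le_trans h1 _.
    by rewrite le_eqVlt; apply/orP; left; apply/eqP; ring.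
  have := sqr_ge0 (a + b); rewrite sqrrD => h1.
  by rewrite sqrrB; lra.
rewrite unlock.
apply: (@le_trans _ _ (\int[P]_w ((2 * (lambda j * lambda k))%:E +
    (\sum_(i < n) h i w)%:E))%E).
  apply: le_integral_nonmeasurable => w; first by rewrite lee_fin sqr_ge0.
  by rewrite -EFinD lee_fin le_h.
rewrite ge0_integralD//; last 3 first.
- by move=> w _; rewrite lee_fin !mulr_ge0// ltW.
- by move=> w _; rewrite lee_fin sumr_ge0.
- by apply/measurable_EFinP; exact: measurable_sum.
rewrite integral_cst//= probability_setT mule1 ge0_integral_EFin_sum//.
apply: (@le_trans _ _ ((2 * (lambda j * lambda k))%:E + \sum_(i < n)
    (n%:R^-1 * (2 * M * (lambda j * lambda k)))%:E)%E).
  by rewrite leeD2l// lee_sum.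
rewrite sumEFin -EFinD lee_fin sumr_const card_ord.
have -> : 2 * (lambda j * lambda k) +
    (n%:R^-1 * (2 * M * (lambda j * lambda k))) *+ n =
    (2 + 2 * M) * (lambda j * lambda k) * 1.
  by rewrite -mulr_natr; field; exact: lt0r_neq0.
have -> : n%:R * (2 + 2 * M) * delta j k * lambda j * lambda k / n%:R =
    (2 + 2 * M) * (lambda j * lambda k) * delta j k.
  by field; exact: lt0r_neq0.
rewrite ler_wpM2l//; last by rewrite /delta; case: ifP; rewrite ?ler1n.
by apply: mulr_ge0; [lra|rewrite mulr_ge0// ltW].
Qed.

Let admissible : set R := [set C | 0 < C /\
  forall j k, dim_index p j -> dim_index p k ->
    ('E_P[fun w => (ip (u j) (Delta w (u k)) ^+ 2)%R] <=
     (C * delta j k * lambda j * lambda k / n%:R)%:E)%E].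

Let C2E : C2 = inf admissible.
Proof.
rewrite /C2 /smallest_C2; congr inf; apply/seteqP; split => C [C0 hC];
  split => // j k jp kp; move: (hC _ _ jp kp); congr (_ <= _)%E;
  congr expectation; apply/funext => w;
  rewrite hs_norm_sandwich//; exact: Delta_self_adjoint.
Qed.

Let admissible_nonempty C1 : sub_gaussian ip P X C1 -> admissible !=set0.
Proof.
move=> sG; exists (n%:R * (2 + 2 * (16 * C1 ^+ 4))).
split; last exact: admissible_constant.
have : 0 <= C1 ^+ 4 by rewrite (exprM _ 2 2) exprn_ge0// sqr_ge0.
by move=> C10; rewrite mulr_gt0//; lra.
Qed.

Lemma smallest_C2_ge0 C1 : sub_gaussian ip P X C1 -> 0 <= C2.
Proof.
move=> /admissible_nonempty ne; rewrite C2E; apply: lb_le_inf => //.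
by move=> C [/ltW].
Qed.

(** The infimum is itself admissible as far as the moment bounds go: for each pair of indices the
    constraint is a closed lower bound on [C]. *)
Lemma smallest_C2_le C1 j k : sub_gaussian ip P X C1 ->
  dim_index p j -> dim_index p k ->
  ('E_P[fun w => (ip (u j) (Delta w (u k)) ^+ 2)%R] <=
   (C2 * delta j k * lambda j * lambda k / n%:R)%:E)%E.
Proof.
move=> sG jp kp; have ne := admissible_nonempty sG.
have c0 : 0 < delta j k * lambda j * lambda k / n%:R.
  by rewrite divr_gt0// !mulr_gt0 ?lambda_gt0// /delta; case: ifP.
have E0 : (0 <= 'E_P[fun w => (ip (u j) (Delta w (u k)) ^+ 2)%R])%E.
  by apply: expectation_ge0 => w; exact: sqr_ge0.
(* Any admissible constant shows that the expectation is finite, so the constraint can be divided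
   out in the reals. *)
have [C' [_ /(_ _ _ jp kp) EC']] := ne.
case E2 : ('E_P[fun w => (ip (u j) (Delta w (u k)) ^+ 2)%R])%E E0 EC'
  => [r||] // _ _.
have cE C : C * delta j k * lambda j * lambda k / n%:R =
    C * (delta j k * lambda j * lambda k / n%:R) by rewrite !mulrA.
rewrite lee_fin cE -ler_pdivrMr// C2E; apply: lb_le_inf => // C.
by case=> _ /(_ _ _ jp kp); rewrite E2 lee_fin cE -ler_pdivrMr.
Qed.

Lemma Delta_sqr_cvg w m :
  \sum_(1 <= k < N.+1 | dim_index p k) ip (u k) (Delta w (u m)) ^+ 2
    @[N --> \oo] --> `|Delta w (u m)| ^+ 2.
Proof.
rewrite -ip_norm; under eq_fun do under eq_bigr do rewrite expr2.
exact: (basis_parseval ip_norm).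
Qed.

Let tr := trace ip p u Sigma.

Let tr_ge N : \sum_(1 <= j < N.+1 | dim_index p j) lambda j <= tr.
Proof. exact: (sum_eigenvalues_le_trace ip_norm X_square Sigma_eigen). Qed.

Lemma trace_ge0 : 0 <= tr.
Proof. by have := tr_ge 0; rewrite big_geq. Qed.

(** Entries are known to be measurable only at indices within the dimension, so the others are
    replaced by zero. *)
Let index_sum_measurable N (f : nat -> T -> R) :
  (forall m, dim_index p m -> measurable_fun [set: T] (f m)) ->
  measurable_fun [set: T]
    (fun w => \sum_(1 <= m < N.+1 | dim_index p m) f m w).
Proof.
move=> mf; rewrite [X in measurable_fun _ X](_ : _ = fun w =>
  \sum_(1 <= m < N.+1) if dim_index p m then f m w else 0); last first.
  by apply/funext => w; rewrite big_mkcond.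
apply: measurable_sum => m; have [mp|_] := boolP (dim_index p m).
  exact: mf.
exact: measurable_cst.
Qed.

Let index_sum_integral N (f : nat -> T -> R) :
  (forall m, dim_index p m -> measurable_fun [set: T] (f m)) ->
  (forall m w, 0 <= f m w) ->
  (\int[P]_w (\sum_(1 <= m < N.+1 | dim_index p m) f m w)%R%:E =
   \sum_(1 <= m < N.+1 | dim_index p m) \int[P]_w (f m w)%:E)%E.
Proof.
move=> mf f0.
transitivity (\int[P]_w (\sum_(1 <= m < N.+1 | dim_index p m)
    (if dim_index p m then f m w else 0))%R%:E)%E.
  apply: eq_integral => w _; congr EFin.
  by apply: eq_bigr => m ->.
rewrite (@ge0_integral_EFin_sum _ _ _ _ _ _ _
    (fun m w => if dim_index p m then f m w else 0)).
- by apply: eq_bigr => m mp; apply: eq_integral => w _; rewrite mp.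
- move=> m; have [mp|_] := boolP (dim_index p m); first exact: mf.
  exact: measurable_cst.
- by move=> m w; case: ifP.
Qed.

Lemma measurable_Delta_sqr m : dim_index p m ->
  measurable_fun [set: T] (fun w => `|Delta w (u m)| ^+ 2).
Proof.
move=> mp; apply: (measurable_fun_cvg (h := fun N w =>
  \sum_(1 <= k < N.+1 | dim_index p k) ip (u k) (Delta w (u m)) ^+ 2)).
  move=> N; apply: index_sum_measurable => k kp.
  by apply: measurable_funX; exact: measurable_Delta.
by move=> w _; exact: Delta_sqr_cvg.
Qed.

Lemma hs_norm_Delta_cvg w :
  \sum_(1 <= m < N.+1 | dim_index p m) `|Delta w (u m)| ^+ 2
    @[N --> \oo] --> hs_norm ip p u (Delta w) ^+ 2.
Proof.
rewrite (hs_normE ip_norm (@Delta_self_adjoint w) (@Delta_hs_summable w)).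
exact: (hs_summable_cvg (@Delta_hs_summable w)).
Qed.

Lemma measurable_hs_norm_Delta :
  measurable_fun [set: T] (fun w => hs_norm ip p u (Delta w) ^+ 2).
Proof.
apply: (measurable_fun_cvg (h := fun N w =>
  \sum_(1 <= m < N.+1 | dim_index p m) `|Delta w (u m)| ^+ 2)).
  move=> N; apply: index_sum_measurable => m; exact: measurable_Delta_sqr.
by move=> w _; exact: hs_norm_Delta_cvg.
Qed.

(** Monotone convergence is applied twice, within each column [Delta (u m)] and then over [m]. Each
    summation of eigenvalues costs one factor [tr], and [delta] is bounded by 2. *)
Lemma expectation_hs_norm_Delta C1 : sub_gaussian ip P X C1 ->
  (\int[P]_w (hs_norm ip p u (Delta w) ^+ 2)%:E <=
   (2 * C2 * tr ^+ 2 / n%:R)%:E)%E.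
Proof.
move=> sG; have C20 := smallest_C2_ge0 sG; have tr0 := trace_ge0.
have c0 : 0 <= 2 * C2 * tr / n%:R by rewrite !mulr_ge0// invr_ge0 ltW.
have E_col m : dim_index p m -> (\int[P]_w (`|Delta w (u m)| ^+ 2)%:E <=
    (2 * C2 * tr / n%:R * lambda m)%:E)%E.
  move=> mp; have lm := lambda_gt0 mp.
  apply: (integral_nd_cvg_le (f := fun N w => \sum_(1 <= k < N.+1 |
      dim_index p k) ip (u k) (Delta w (u m)) ^+ 2)).
  - move=> N; apply: index_sum_measurable => k kp.
    by apply: measurable_funX; exact: measurable_Delta.
  - by move=> N w; apply: sumr_ge0 => k _; exact: sqr_ge0.
  - by move=> w; apply: index_sum_nd => k _; exact: sqr_ge0.
  - by move=> w; exact: Delta_sqr_cvg.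
  move=> N; rewrite index_sum_integral; last 2 first.
  - by move=> k kp; apply: measurable_funX; exact: measurable_Delta.
  - by move=> k w; exact: sqr_ge0.
  apply: (@le_trans _ _ (\sum_(1 <= k < N.+1 | dim_index p k)
      (2 * C2 / n%:R * lambda m * lambda k)%:E)%E).
    apply: lee_sum => k kp; have := smallest_C2_le sG kp mp.
    rewrite unlock => /le_trans; apply; rewrite lee_fin.
    have lk := lambda_gt0 kp.
    have -> : 2 * C2 / n%:R * lambda m * lambda k =
      C2 * (lambda k * lambda m / n%:R) * 2 by ring.
    have -> : C2 * delta k m * lambda k * lambda m / n%:R =
      C2 * (lambda k * lambda m / n%:R) * delta k m by ring.
    rewrite ler_wpM2l//; last by rewrite /delta; case: ifP; rewrite ?ler1n.
    by rewrite mulr_ge0// divr_ge0 ?ltW// mulr_gt0.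
  rewrite sumEFin lee_fin -mulr_sumr.
  have -> : 2 * C2 * tr / n%:R * lambda m = 2 * C2 / n%:R * lambda m * tr.
    by ring.
  by rewrite ler_wpM2l// !mulr_ge0 ?invr_ge0// ltW.
have -> : 2 * C2 * tr ^+ 2 / n%:R = 2 * C2 * tr / n%:R * tr by ring.
apply: (integral_nd_cvg_le (f := fun N w => \sum_(1 <= m < N.+1 |
    dim_index p m) `|Delta w (u m)| ^+ 2)).
- move=> N; apply: index_sum_measurable => m; exact: measurable_Delta_sqr.
- by move=> N w; apply: sumr_ge0 => m _; exact: exprn_ge0.
- by move=> w; apply: index_sum_nd => m _; exact: exprn_ge0.
- by move=> w; exact: hs_norm_Delta_cvg.
move=> N; rewrite index_sum_integral; last 2 first.
- exact: measurable_Delta_sqr.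
- by move=> m w; exact: exprn_ge0.
apply: (@le_trans _ _ (\sum_(1 <= m < N.+1 | dim_index p m)
    (2 * C2 * tr / n%:R * lambda m)%:E)%E).
  by apply: lee_sum => m mp; exact: E_col.
by rewrite sumEFin lee_fin -mulr_sumr ler_wpM2l.
Qed.

End pca.

(** * Excess risk: elimination of [B] and conclusion *)

Section excess.
Context (R : realType) (H : completeNormedModType R).
Variable ip : {dot H for idfun}.
Hypothesis ip_norm : is_hilbert_norm ip.

Lemma pca_excess_bounds p (S Sh : H -> H) lambda lambdah u uh d :
  self_adjoint ip S -> self_adjoint ip Sh ->
  eigen_decomposition ip p S lambda u ->
  eigen_decomposition ip p Sh lambdah uh ->
  hs_summable p u (S - Sh) -> (0 < d)%N -> lt_dim d p ->
  let E := hs_inner ip p u S (proj_le ip u d - proj_le ip uh d) in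
  let A := hs_norm ip p u (S - Sh) ^+ 2 in
  let gap := lambda d - lambda d.+1 in
  [/\ 0 <= E, 0 <= gap,
      forall t, 0 < t -> E <= t / 2 * A + t^-1 * d%:R &
      0 < gap -> E <= 2 / gap * A].
Proof.
move=> Ssa Shsa Seig Sheig Dsum d0 dp E A gap.
have [B [B0 Bd BE EB]] :=
  pca_risk_bounds ip_norm Ssa Shsa Seig Sheig Dsum d0 dp.
rewrite -/E -/A -/gap in BE EB.
have gap0 : 0 <= gap.
  have [_ _ mono _] := Seig.
  by rewrite subr_ge0 mono// (dim_index_le dp)// d0/=.
split => // [|t t0|gap_gt0].
- by have := mulr_ge0 gap0 B0; lra.
- have : t^-1 * B <= t^-1 * (2 * d%:R) by rewrite ler_wpM2l// invr_ge0 ltW.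
  by have := EB t t0; lra.
- have : gap / 2 * B <= E by lra.
  (* With [t = 2 / gap] the term [t^-1 * B] is [gap / 2 * B], at most [E]; it cancels one of the two
     copies of [E] on the left. *)
  have := EB _ (divr_gt0 (ltr0Sn _ 1) gap_gt0); rewrite invf_div; lra.
Qed.

End excess.

Theorem proposition2p2
    (R : realType) (H : completeNormedModType R) (ip : {dot H for idfun})
    (ip_norm : is_hilbert_norm ip)
    (p : option nat)
    (disp : measure_display) (T : measurableType disp) (P : probability T R)
    (X : {RV P >-> borel H})
    (X_centered : is_expectation ip P X 0)
    (X_square : ('E_P[fun w => (`|X w : H| ^+ 2)%R] < +oo)%E)
    (lambda : nat -> R) (u : nat -> H)
    (Sigma_eigen :
      eigen_decomposition ip p (covariance_operator ip P X) lambda u)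
    (lambda_gt0 : forall j, dim_index p j -> 0 < lambda j)
    (n : nat) (n_ge1 : (1 <= n)%N)
    (Xs : 'I_n -> {RV P >-> borel H})
    (Xs_copies : independent_copies P X Xs)
    (lambdah : T -> nat -> R) (uh : T -> nat -> H)
    (Sigmah_eigen : forall w,
      eigen_decomposition ip p (empirical_covariance ip Xs w)
        (lambdah w) (uh w))
    (d : nat) (d_ge1 : (1 <= d)%N) (d_lt_p : lt_dim d p) :
  let Sigma := covariance_operator ip P X in
  let Delta w := Sigma - empirical_covariance ip Xs w in
  let excess w := excess_risk ip P p u d X (uh w) in
  let gap := lambda d - lambda d.+1 in
  (forall w,
    ((excess w)%:E <=
      mine (Num.sqrt (2 * d%:R) * hs_norm ip p u (Delta w))%R%:E
           (xdiv (2 * hs_norm ip p u (Delta w) ^+ 2)%R gap))%E)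
  /\
  (forall C1 : R, sub_gaussian ip P X C1 ->
    let C2 := smallest_C2 ip P p lambda u X Xs in
    ('E_P[excess] <=
      mine (Num.sqrt (4 * C2 * d%:R) * trace ip p u Sigma / Num.sqrt n%:R)%R%:E
           (xdiv (4 * C2 * trace ip p u Sigma ^+ 2)%R
                 (n%:R * gap)%R))%E).
Proof.
move=> Sigma Delta excess gap.
have [_ copies] := Xs_copies.
have bounds w : [/\ 0 <= excess w, 0 <= gap,
    forall t, 0 < t -> excess w <=
      t / 2 * hs_norm ip p u (Delta w) ^+ 2 + t^-1 * d%:R &
    0 < gap -> excess w <= 2 / gap * hs_norm ip p u (Delta w) ^+ 2].
  apply: (pca_excess_bounds ip_norm _ _ Sigma_eigen (Sigmah_eigen w)) => //.
  - exact: (covariance_self_adjoint ip_norm X_square Sigma_eigen lambda_gt0).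
  - exact: empirical_self_adjoint.
  - exact: (Delta_hs_summable ip_norm X_square Sigma_eigen lambda_gt0).
have gap0 : 0 <= gap by have [] := bounds point.
split=> [w|C1 sG].
  have [_ _ Et Egap] := bounds w.
  have hs0 := hs_norm_ge0 ip p u (Delta w).
  rewrite le_min; apply/andP; split.
    rewrite lee_fin; apply: (le_mul_AMGM hs0 (sqrtr_ge0 _)) => t t0.
    have := Et t t0; rewrite (@sqr_sqrtr _ (2 * d%:R)) ?mulr_ge0//.
    lra.
  rewrite /xdiv; case: eqP => [_|/eqP gapN0]; first exact: leey.
  rewrite lee_fin mulrAC; apply: Egap.
  by rewrite lt_def gapN0 gap0.
set C2 := smallest_C2 _ _ _ _ _ _ _; cbv zeta.
have C20 : 0 <= C2.
  exact: (smallest_C2_ge0 ip_norm X_square Sigma_eigen lambda_gt0 n_ge1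
    copies sG).
have tr0 : 0 <= trace ip p u Sigma.
  exact: (trace_ge0 ip_norm X_square Sigma_eigen lambda_gt0).
have n0 : 0 < n%:R :> R by rewrite ltr0n.
pose V := 2 * C2 * trace ip p u Sigma ^+ 2 / n%:R.
have V0 : 0 <= V.
  by apply: divr_ge0; [rewrite !mulr_ge0 ?exprn_ge0|exact: ltW].
have EV : (\int[P]_w (hs_norm ip p u (Delta w) ^+ 2)%:E <= V%:E)%E.
  exact: (expectation_hs_norm_Delta ip_norm X_square Sigma_eigen lambda_gt0
    n_ge1 copies sG).
have mhs : measurable_fun [set: T] (fun w => hs_norm ip p u (Delta w) ^+ 2).
  exact: (measurable_hs_norm_Delta ip_norm X_square Sigma_eigen lambda_gt0).
(* Both bounds in expectation are instances of this. Only the dominating function has to be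
   measurable; [excess] just has to be nonnegative. *)
have E_affine (a b : R) : 0 <= a -> 0 <= b ->
    (forall w, excess w <= a * hs_norm ip p u (Delta w) ^+ 2 + b) ->
    ('E_P[excess] <= (a * V + b)%:E)%E.
  move=> a0 b0 le_ab; rewrite unlock.
  apply: (@le_trans _ _ (\int[P]_w
      ((a%:E * (hs_norm ip p u (Delta w) ^+ 2)%:E) + b%:E))%E).
    apply: le_integral_nonmeasurable => w; first by have [] := bounds w.
    by rewrite -EFinM -EFinD lee_fin.
  have mhsE : measurable_fun [set: T]
      (fun w => (hs_norm ip p u (Delta w) ^+ 2)%:E) by exact/measurable_EFinP.
  rewrite ge0_integralD//; last 2 first.
  - by move=> w _; rewrite -EFinM lee_fin mulr_ge0// exprn_ge0// hs_norm_ge0.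
  - exact: emeasurable_funM.
  rewrite integral_cst//= probability_setT mule1 EFinD leeD2r//.
  rewrite ge0_integralZl//; last first.
    by move=> w _; rewrite lee_fin exprn_ge0// hs_norm_ge0.
  by rewrite EFinM lee_wpmul2l// lee_fin.
rewrite le_min; apply/andP; split.
  have : (0 <= 'E_P[excess])%E.
    by apply: expectation_ge0 => w; have [] := bounds w.
  have E_t t : 0 < t -> ('E_P[excess] <= (t / 2 * V + t^-1 * d%:R)%:E)%E.
    move=> t0; apply: E_affine => [||w].
    - by rewrite divr_ge0// ltW.
    - by rewrite mulr_ge0// invr_ge0 ltW.
    - by have [_ _ Et _] := bounds w; exact: Et.
  (* One value of [t] suffices to see that the expectation is finite, after which the optimisation
     over [t] takes place in the reals. *)
  have := E_t 1 ltr01.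
  case: ('E_P[excess])%E E_t => [r||] // E_t _ _; rewrite lee_fin.
  have -> : Num.sqrt (4 * C2 * d%:R) * trace ip p u Sigma / Num.sqrt n%:R =
      Num.sqrt (2 * d%:R) * Num.sqrt V.
    rewrite -sqrtrM ?mulr_ge0// /V.
    have -> : 2 * d%:R * (2 * C2 * trace ip p u Sigma ^+ 2 / n%:R) =
      (4 * C2 * d%:R) * trace ip p u Sigma ^+ 2 * n%:R^-1 by ring.
    have K0 : 0 <= 4 * C2 * d%:R by rewrite !mulr_ge0.
    rewrite [in RHS]sqrtrM; last by rewrite mulr_ge0// exprn_ge0.
    by rewrite (sqrtrM _ K0) sqrtr_sqr (ger0_norm tr0) sqrtrV//.
  apply: (le_mul_AMGM (sqrtr_ge0 _) (sqrtr_ge0 _)) => t t0.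
  have := E_t t t0; rewrite lee_fin !sqr_sqrtr ?mulr_ge0//.
  lra.
rewrite /xdiv; case: eqP => [_|/eqP]; first exact: leey.
rewrite mulf_eq0 negb_or => /andP[_ gapN0].
have gap_gt0 : 0 < gap by rewrite lt_def gapN0 gap0.
(* The affine bound is used with slope [2 / gap] and intercept 0; the 4 is this 2 times the 2 in
   [V]. *)
have -> : 4 * C2 * trace ip p u Sigma ^+ 2 / (n%:R * gap) = 2 / gap * V + 0.
  by rewrite /V; field; rewrite gapN0 lt0r_neq0.
apply: E_affine => // [|w]; first by rewrite divr_ge0.
by rewrite addr0; have [_ _ _] := bounds w; apply.
Qed.
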